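(* Let $n\ge 1$ and let $\alpha$ be a composition. The quasiGrothendieck polynomial $\overline{S}_\alpha=\overline{S}_\alpha^{(\beta)}(x_1,\dots,x_n)\in \mathrm{QSym}_n[\beta]$ is a positive sum of multifundamental quasisymmetric polynomials; that is, \[ \overline{S}_\alpha=\sum_\gamma J^\alpha_\gamma\,\overline{F}_\gamma , \] where the (finite) sum is over compositions $\gamma$, $\overline{F}_\gamma=\overline{F}_\gamma^{(\beta)}(x_1,\dots,x_n)$, and each $J^\alpha_\gamma\in\mathbb{Z}_{\ge 0}[\beta]$ is a polynomial in $\beta$ with nonnegative integer coefficients.
   Context: Fix $n\ge1$; $\beta$ is a formal parameter. A weak composition of length $n$ is a sequence $a=(a_1,\dots,a_n)$ of nonnegative integers, $|a|=\sum_i a_i$, and $\mathbf{x}^a=x_1^{a_1}\cdots x_n^{a_n}$. A composition is a finite sequence of positive integers. The positive part $a^+$ of $a$ is the composition obtained by deleting all zeros of $a$. $\mathrm{QSym}_n\subset\mathbb{Z}[x_1,\dots,x_n]$ denotes the quasisymmetric polynomials. Lascoux atoms. The skyline diagram $D(a)$ has $a_i$ left-justified boxes in row $i$; row $1$ is the lowest row. A triple consists of three boxes, two of them adjacent in a row (left box with entry $\beta'$, right box with entry $\alpha'$) and a third box with entry $\gamma'$, such that either (Type A) the third box is above the right box, in the same column as it, and the lower of the two rows is weakly longer, or (Type B) the third box is below the left box, in the same column as it, and the higher of the two rows is strictly longer. A triple is an inversion triple if $\gamma'<\alpha'\le\beta'$ or $\alpha'\le\beta'<\gamma'$. A set-valued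 filling assigns a nonempty set of positive integers to each box; the maximum of each box is its anchor, all other entries are free. It is semistandard if (S.1) entries do not repeat in a column; (S.2) rows are weakly decreasing from left to right, where $A\ge B$ means $\min A\ge\max B$; (S.3) every triple of anchors is an inversion triple; (S.4) each free entry is in the cell of the least anchor in its column such that (S.2) is not violated (i.e. among the cells of its column with larger anchor in which it could be placed without violating (S.2), it is in the one with least anchor); (S.5) anchors in the first column equal their row index. Let $\overline{\mathfrak{A}}\mathsf{SSF}(a)$ be the set of semistandard set-valued fillings of $D(a)$. For a filling $F$, $\mathrm{wt}(F)=(c_1,\dots,c_n)$ with $c_i$ the number of $i$'s in $F$, and $\mathrm{ex}(F)$ is the number of free entries. The Lascoux atom is $\overline{\mathfrak{A}}_a^{(\beta)}=\sum_{F\in\overline{\mathfrak{A}}\mathsf{SSF}(a)}\beta^{\mathrm{ex}(F)}\mathbf{x}^{\mathrm{wt}(F)}$. QuasiGrothendieck polynomials. $\overline{S}_\alpha^{(\beta)}(x_1,\dots,x_n)=\sum_{a^+=\alpha}\overline{\mathfrak{A}}_a^{(\beta)}$, the sum over weak compositions $a$ of length $n$ with $a^+=\alpha$. Multifundamental quasisymmetric polynomials. A weak komposition is a weak composition whose positive entries are each colored black or red (different colorings are different weak kompositions); its excess $\mathrm{ex}$ is the number of red entries. For a weak composition $a$ of length $n$ with nonzero entries exactly in positions $n_1<\dots<n_\ell$, a weak komposition $b$ of length $n$ is a glide of $a$ if there exist integers $0=i_0<i_1<\dots<i_\ell$ such that $b_k=0$ for $k>i_\ell$ and, for each $1\le j\le\ell$: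 $a_{n_j}=b_{i_{j-1}+1}+\dots+b_{i_j}-\mathrm{ex}(b_{i_{j-1}+1},\dots,b_{i_j})$; $i_j\le n_j$; and the leftmost nonzero entry among $b_{i_{j-1}+1},\dots,b_{i_j}$ is black. The glide polynomial is $\overline{\mathfrak{F}}_a^{(\beta)}=\sum_b\beta^{\mathrm{ex}(b)}\mathbf{x}^b$ over all glides $b$ of $a$. For a composition $\gamma$ with $\ell(\gamma)\le n$ parts, the multifundamental quasisymmetric polynomial is $\overline{F}_\gamma^{(\beta)}(x_1,\dots,x_n)=\overline{\mathfrak{F}}^{(\beta)}_{(0,\dots,0,\gamma_1,\dots,\gamma_{\ell(\gamma)})}$, with $n-\ell(\gamma)$ leading zeros; it is $0$ if $\ell(\gamma)>n$. *)

(* Defs.v *)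
From mathcomp Require Import all_boot all_order all_algebra.
From mathcomp Require Import mpoly.

Set Implicit Arguments.
Unset Strict Implicit.
Unset Printing Implicit Defensive.

Import Order.TTheory GRing.Theory Num.Theory.

Local Open Scope ring_scope.

(* Conventions: Z[beta] is {poly int} with beta = 'X, and Z[x_1..x_n][beta] is
   {mpoly {poly int}[n]}.  Positions, rows and filling entries k = 1..n are
   0-indexed, the ordinal i : 'I_n standing for i + 1.  A weak composition of
   length n is a multi-exponent 'X_{1..n}. *)

Definition is_composition (g : seq nat) : bool := all (fun k => 0 < k)%N g.

Section Defs.

Variable n : nat.

Definition positive_positions (a : 'X_{1..n}) : seq 'I_n :=
  [seq i <- enum 'I_n | (0 < a i)%N].

Definition positive_part (a : 'X_{1..n}) : seq nat :=
  [seq a i | i <- positive_positions a].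

Definition is_quasisymmetric (p : {mpoly {poly int}[n]}) : Prop :=
  forall m1 m2 : 'X_{1..n},
    positive_part m1 = positive_part m2 -> p@_m1 = p@_m2.

Section Lascoux.

Variable a : 'X_{1..n}.

Definition box : Type := {i : 'I_n & 'I_(a i)}.

Definition box_row (u : box) : 'I_n := tag u.
Definition box_col (u : box) : nat := tagged u.

(* Entries larger than n need not be considered: the entries of row i are at
   most the anchor of its first box by S2, and that anchor is i by S5. *)
Definition filling : Type := {ffun box -> {set 'I_n}}.

Implicit Types F : filling.

Definition is_set_valued F : bool := [forall u, F u != set0].

Definition anchor F (u : box) : nat := (\max_(x in F u) x)%N.

Definition free_entries F (u : box) : {set 'I_n} :=
  [set x in F u | (x : nat) != anchor F u].

Definition same_col (u v : box) : bool := box_col u == box_col v.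

Definition adjacent (u v : box) : bool :=
  (box_row u == box_row v) && (box_col v == (box_col u).+1).

(* min A >= max B, for nonempty A and B *)
Definition set_geq (A B : {set 'I_n}) : bool :=
  [forall x in A, forall y in B, (y <= x)%N].

Definition S1 F : bool :=
  [forall u, forall v, (same_col u v && (u != v)) ==> [disjoint F u & F v]].

Definition S2 F : bool :=
  [forall u, forall v, adjacent u v ==> set_geq (F u) (F v)].

Definition triple_A (u v w : box) : bool :=
  [&& adjacent u v, same_col w v, (box_row v < box_row w)%N
    & (a (box_row w) <= a (box_row u))%N].

Definition triple_B (u v w : box) : bool :=
  [&& adjacent u v, same_col w u, (box_row w < box_row u)%N
    & (a (box_row w) < a (box_row u))%N].

(* left, right and third are the entries called beta', alpha' and gamma' *)
Definition is_inversion (left right third : nat) : bool :=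
  (third < right <= left)%N || (right <= left < third)%N.

Definition S3 F : bool :=
  [forall u, forall v, forall w,
    (triple_A u v w || triple_B u v w) ==>
    is_inversion (anchor F u) (anchor F v) (anchor F w)].

Definition move_entry F (x : 'I_n) (u v : box) : filling :=
  [ffun w => if w == v then x |: F w
             else if w == u then F w :\ x
             else F w].

Definition S4 F : bool :=
  [forall u, forall x in free_entries F u, forall v,
    [&& same_col u v, (x < anchor F v)%N & S2 (move_entry F x u v)] ==>
    (anchor F u <= anchor F v)%N].

Definition S5 F : bool :=
  [forall u, (box_col u == 0%N) ==> (anchor F u == box_row u)].

Definition semistandard F : bool :=
  [&& is_set_valued F, S1 F, S2 F, S3 F, S4 F & S5 F].

Definition filling_wt F : 'X_{1..n} :=
  [multinom #|[set u | i \in F u]| | i < n].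

Definition filling_ex F : nat := (\sum_u #|free_entries F u|)%N.

Definition lascoux_atom : {mpoly {poly int}[n]} :=
  \sum_(F : filling | semistandard F)
    ('X ^+ filling_ex F : {poly int}) *: 'X_[filling_wt F].

End Lascoux.

(* a^+ = alpha forces |a| = |alpha|, so that bounding the degree of a discards
   nothing. *)
Definition quasiGrothendieck (alpha : seq nat) : {mpoly {poly int}[n]} :=
  \sum_(a : 'X_{1..n < (sumn alpha).+1} | positive_part a == alpha)
    lascoux_atom a.

(* A weak komposition is a weak composition b with the set of its red
   positions; the other positive entries are black. *)
Definition is_weak_komposition (b : 'X_{1..n}) (red : {set 'I_n}) : bool :=
  [forall k in red, (0 < b k)%N].

(* The positions i, ..., j - 1, that is, i + 1, ..., j when counted from 1. *)
Definition block (i j : nat) : {set 'I_n} := [set k : 'I_n | (i <= k < j)%N].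

Definition leftmost_black (b : 'X_{1..n}) (red B : {set 'I_n}) : bool :=
  [exists k in B, [&& (0 < b k)%N, k \notin red
    & [forall k' in B, (k' < k)%N ==> (b k' == 0%N)]]].

(* p lists n_1 - 1 < ... < n_l - 1.  The cut points i_0 < ... < i_l range over
   0..n because of i_j <= n_j <= n. *)
Definition is_glide (a b : 'X_{1..n}) (red : {set 'I_n}) : bool :=
  let p := positive_positions a in
  is_weak_komposition b red &&
  [exists i : {ffun 'I_(size p).+1 -> 'I_n.+1},
    [&& i ord0 == 0%N :> nat,
        [forall k : 'I_n, (i ord_max <= k)%N ==> (b k == 0%N)]
      & [forall j : 'I_(size p),
          let lo : nat := i (widen_ord (leqnSn _) j) in
          let hi : nat := i (lift ord0 j) in
          let nj := tnth (in_tuple p) j in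
          [&& (lo < hi)%N,
              (a nj + #|red :&: block lo hi| == \sum_(k in block lo hi) b k)%N,
              (hi <= nj.+1)%N
            & leftmost_black b red (block lo hi)]]]].

(* A glide b of a satisfies |b| = |a| + ex(b) <= |a| + n, so that bounding the
   degree of b discards nothing. *)
Definition glide_poly (a : 'X_{1..n}) : {mpoly {poly int}[n]} :=
  \sum_(b : 'X_{1..n < (mdeg a + n).+1} * {set 'I_n} | is_glide a b.1 b.2)
    ('X ^+ #|b.2| : {poly int}) *: 'X_[b.1].

Definition pad_left (g : seq nat) : 'X_{1..n} :=
  [multinom nth 0%N (nseq (n - size g) 0%N ++ g) i | i < n].

Definition multifundamental (g : seq nat) : {mpoly {poly int}[n]} :=
  if (size g <= n)%N then glide_poly (pad_left g) else 0.

End Defs.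

Arguments quasiGrothendieck n alpha : clear implicits.
Arguments multifundamental n g : clear implicits.

(* Main.v *)
Require Import Defs.
From mathcomp Require Import all_boot all_order all_algebra.
From mathcomp Require Import mpoly.
From mathcomp Require Import zify.

Set Implicit Arguments.
Unset Strict Implicit.
Unset Printing Implicit Defensive.

(* Read the entries of a semistandard filling by increasing value, equal values
   from right to left, and record the box of each entry; boxes in one row are
   read from right to left, so the semistandardness conditions only compare
   entries in this reading order.  Merging consecutive entries that lie in the
   same box turns this list into a word w of boxes without equal neighbours,
   and w alone decides whether the filling is semistandard.  This remains true
   when the anchors of the first column, hence the shape a, vary with a^+
   fixed.  The fillings with a given word w are the ways to distribute values
   along w, weakly increasing, strictly where the column does not decrease; a
   letter of w may receive several values.  These are the glides of the
   composition gamma(w) cut out by the non-decreases of the column, a value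
   being red when its first occurrence was merged into the preceding entry.
   So the fillings with word w contribute
   beta^(|w| - |alpha|) F_gamma(w). *)

(** * Merging blocks into a word *)

Section Glue.
Variables (T : eqType) (x0 : T).
Implicit Types (w b : seq T) (B : nat -> seq T).

Definition overlaps w b := [&& 0 < size w, 0 < size b & last x0 w == head x0 b].
Definition glue w b := w ++ drop (overlaps w b) b.
Fixpoint merged B k := if k is k'.+1 then glue (merged B k') (B k') else [::].
Definition slice i j w := drop i (take j w).
Definition stutter_free w := sorted (fun x y => x != y) w.
(* Truncation is harmless: r k will imply f k > 0. *)
Definition psum (f : nat -> nat) (r : nat -> bool) k := \sum_(i < k) (f i - r i).
(** Block k will count as red exactly when its first letter is absorbed by the last letter of the
    word built so far. *)
Definition red_at B k := overlaps (merged B k) (B k).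

Lemma psumS f r k : psum f r k.+1 = psum f r k + (f k - r k).
Proof. by rewrite /psum big_ord_recr. Qed.

Lemma psum_mono f r : {homo psum f r : i j / i <= j}.
Proof.
apply: homo_leq => [//|i j k|k]; [exact: leq_trans | by rewrite psumS leq_addr].
Qed.

Lemma size_merged B k : size (merged B k) = psum (size \o B) (red_at B) k.
Proof.
elim: k => [|k IHk]; first by rewrite /psum big_ord0.
by rewrite psumS /= /glue size_cat size_drop IHk.
Qed.

Lemma merged_prefix B k n : k <= n -> take (size (merged B k)) (merged B n) = merged B k.
Proof.
elim: n => [|n IHn]; first by rewrite leqn0 => /eqP->.
rewrite leq_eqVlt ltnS => /predU1P[->|le_kn]; first by rewrite take_size.
have /(congr1 size) := IHn le_kn; rewrite size_take_min => sz.
rewrite /= /glue takel_cat ?IHn //.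
by rewrite -sz geq_minr.
Qed.

(** Gluing only appends, so a block stays where it was placed; it begins one letter early exactly
    when its first letter was merged. *)
Lemma merged_slice B k n : k < n ->
  B k = slice (size (merged B k) - red_at B k) (size (merged B k.+1)) (merged B n).
Proof.
move=> ltkn; rewrite /slice merged_prefix //= /glue -/(red_at B k).
case E: (red_at B k); last by rewrite subn0 drop_size_cat ?drop0.
have /and3P[] := E; case: (lastP (merged B k)) => // w x _.
case: (B k) => // y b _; rewrite last_rcons /= => /eqP ->.
by rewrite size_rcons subn1 /= drop0 -cats1 -catA drop_size_cat.
Qed.

Lemma stutter_free_merged B n :
  (forall k, k < n -> stutter_free (B k)) -> stutter_free (merged B n).
Proof.
elim: n => [//|n IHn] sf; have {IHn} := IHn (fun k h => sf k (ltnW h)).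
have := sf n (leqnn _); rewrite /= /glue /overlaps.
case: (merged B n) => [|y w]; first by rewrite drop0.
case: (B n) => [|x b]; first by rewrite cats0.
rewrite /stutter_free /= => hb hw; rewrite cat_path hw /=.
case: eqP => [->|/eqP ne] /=; first by rewrite drop0.
by rewrite ne.
Qed.

Lemma size_slice i j w : j <= size w -> size (slice i j w) = j - i.
Proof. by move=> le_j; rewrite size_drop size_takel. Qed.

Lemma mem_slice i j w u : j <= size w ->
  reflect (exists2 p, i <= p < j & nth x0 w p = u) (u \in slice i j w).
Proof.
move=> le_j; apply: (iffP (nthP x0)); rewrite size_slice //.
  by case=> p lt_p <-; exists (i + p); [lia | rewrite nth_drop nth_take //; lia].
case=> p /andP[le_ip lt_pj] <-; exists (p - i); first by lia.
by rewrite nth_drop subnKC // nth_take.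
Qed.

Lemma head_slice i j w : i < j -> head x0 (slice i j w) = nth x0 w i.
Proof. by move=> ltij; rewrite -nth0 /slice nth_drop addn0 nth_take. Qed.

Variables (w : seq T) (n : nat) (f : nat -> nat) (r : nat -> bool).
Hypotheses (wsf : stutter_free w) (szw : psum f r n = size w).
Hypothesis red_ok : forall k, k < n -> r k -> 0 < f k /\ 0 < psum f r k.

(** The letters that receive value k; a red value starts by reusing the last letter of its
    predecessors. *)
Definition glide_block k := slice (psum f r k - r k) (psum f r k.+1) w.

Lemma size_glide_block k : k < n -> size (glide_block k) = f k.
Proof.
move=> ltkn; rewrite /glide_block size_slice; last by rewrite -szw psum_mono.
rewrite psumS; have := red_ok ltkn; case: (r k) => [/(_ isT)[]|_]; lia.
Qed.

(** Cutting and gluing are inverse to each other: since the word has no equal neighbours, blocks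
    that were cut without a shared letter are not merged by accident. *)
Lemma merged_glide_block k : k <= n ->
  merged glide_block k = take (psum f r k) w /\
  (k < n -> red_at glide_block k = r k).
Proof.
elim: k => [|k IHk] le_kn.
  rewrite /psum big_ord0 take0; split=> // lt0n; apply/esym/negP => /(red_ok lt0n) [_].
  by rewrite /psum big_ord0.
have [mk /(_ le_kn) rk] := IHk (ltnW le_kn).
have mk1 : merged glide_block k.+1 = take (psum f r k.+1) w.
  rewrite /= /glue -/(red_at _ k) rk mk /glide_block /slice drop_drop.
  have -> : r k + (psum f r k - r k) = psum f r k.
    by have := red_ok le_kn; case: (r k) => [/(_ isT)[]|_]; lia.
  have le : psum f r k <= psum f r k.+1 by rewrite psum_mono.
  by rewrite -[take (psum f r k) w](take_takel _ le) cat_take_drop.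
split=> // lt_kn; rewrite /red_at /overlaps mk1 size_glide_block //.
have le : psum f r k.+1 <= size w by rewrite -szw psum_mono // ltnW.
rewrite size_takel // /glide_block.
have last_take : 0 < psum f r k.+1 ->
    last x0 (take (psum f r k.+1) w) = nth x0 w (psum f r k.+1).-1.
  by move=> lt0; rewrite -nth_last size_takel // nth_take //; lia.
have := red_ok lt_kn; case E: (r k.+1).
  move=> /(_ isT)[f0 A0]; rewrite f0 A0 last_take // head_slice subn1 ?eqxx //.
  by rewrite [psum f r k.+2]psumS ?E; lia.
move=> _; apply/and3P => -[A0 f0]; rewrite last_take // head_slice subn0; last first.
  by rewrite [psum f r k.+2]psumS ?E; lia.
(* An overlap without [r k.+1] would give equal neighbours in [w], unless the word is already
   exhausted; but then the block is empty. *)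
have /(sortedP x0)/(_ (psum f r k.+1).-1) := wsf.
rewrite prednK // => neq /eqP eq_w.
have := neq; rewrite eq_w eqxx => /implyP; rewrite implybF -leqNgt => ge.
by have := psum_mono f r lt_kn; rewrite szw [psum f r k.+2]psumS E; lia.
Qed.

End Glue.

(** * Semistandardness in terms of the reading order *)

(** A cell (r, c) lies in column c of the r-th nonempty row from below, both counted from 0; thus
    all shapes with the same positive part share their cells. *)
Definition cell : Type := (nat * nat)%type.

Section Abstract.
Variable alpha : seq nat.
Implicit Types (u v : cell) (P : cell -> pred nat).

(* The reading order on entries x of u and y of v: equal values are read from
   right to left. *)
Definition prec u x v y := (x < y) || ((x == y) && (v.2 < u.2)).

Lemma prec_leq u x v y : prec u x v y -> x <= y.
Proof. by case/orP=> [/ltnW//|/andP[/eqP->]]. Qed.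

Definition is_anchor P u x := P u x /\ forall y, P u y -> y <= x.

(* With u and its right neighbour, t completes a triple of type A (first
   disjunct) or of type B. *)
Definition third_cell u t :=
  (t.2 == u.2.+1) && (u.1 < t.1) && (nth 0 alpha t.1 <= nth 0 alpha u.1) ||
  (t.2 == u.2) && (t.1 < u.1) && (nth 0 alpha t.1 < nth 0 alpha u.1).

(** S1 to S5 for the relation [P u x] (x is an entry of u), with entries of different cells compared
    through [prec] or by mere equality. Of S5 only the increase of the first-column anchors is kept:
    it allows the rows to be chosen afterwards. *)
Record semistandard_on P : Prop := SemistandardOn {
  sso_dom : forall u, (u.2 < nth 0 alpha u.1) <-> exists x, P u x;
  sso_col : forall u v x, P u x -> P v x -> u.2 = v.2 -> u = v;
  sso_row : forall r c x y, P (r, c) x -> P (r, c.+1) y -> prec (r, c.+1) y (r, c) x;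
  sso_triple : forall r c t x y z, third_cell (r, c) t ->
    is_anchor P (r, c) x -> is_anchor P (r, c.+1) y -> is_anchor P t z ->
    prec t z (r, c.+1) y || prec (r, c) x t z;
  sso_free : forall u v x y z, P u x -> is_anchor P u y -> is_anchor P v z ->
    u != v -> u.2 = v.2 -> prec u x v z ->
    (forall t, P (v.1, v.2.+1) t -> prec (v.1, v.2.+1) t u x) ->
    (forall c t, v.2 = c.+1 -> P (v.1, c) t -> prec u x (v.1, c) t) ->
    prec u y v z;
  sso_first : forall r r' x y, r < r' -> is_anchor P (r, 0) x -> is_anchor P (r', 0) y ->
    prec (r, 0) x (r', 0) y }.

(** The conditions see only [prec] between different cells and the maximum within a cell, so any
    correspondence respecting both carries them over. Within a cell weak monotonicity suffices; [R]
    is not a function in general, as one letter of a word may carry several values. *)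
Lemma semistandard_on_transfer (P P' : cell -> pred nat) (n : nat)
    (R : cell -> nat -> nat -> Prop) :
  (forall u x, P u x -> x <= n) ->
  (forall u x i, R u x i -> P u x /\ P' u i) ->
  (forall u x, P u x -> exists i, R u x i) ->
  (forall u i, P' u i -> exists x, R u x i) ->
  (forall u v x y i j, u != v -> R u x i -> R v y j -> prec u x v y = prec u i v j) ->
  (forall u x y i j, R u x i -> R u y j -> x < y -> i <= j) ->
  semistandard_on P -> semistandard_on P'.
Proof.
move=> bound RP PR P'R Rne Req [dom col row triple free first].
(* Anchors correspond to anchors: the maximum y of u in [P] has a partner i; monotonicity gives j <=
   i and maximality of j gives i <= j. *)
have anchR u j : is_anchor P' u j -> exists2 y, is_anchor P u y & R u y j.
  move=> [Pj maxj]; have [t Rt] := P'R _ _ Pj.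
  have [Pt _] := RP _ _ _ Rt.
  have exP : exists x, P u x by exists t.
  have [y Py maxy] := ex_maxnP exP (bound u).
  have [i Ri] := PR _ _ Py.
  exists y => //; have := maxy _ Pt; rewrite leq_eqVlt => /predU1P[<- //|lt_ty].
  have le_ij : i <= j by apply: maxj; case: (RP _ _ _ Ri).
  have le_ji := Req _ _ _ _ _ Rt Ri lt_ty.
  by have -> : j = i by lia.
have ne1 r c : (r, c) != (r, c.+1) by apply/eqP => -[]; lia.
split.
- move=> u; split=> [/dom[x /PR[i /RP[_ Pi]]]|[i /P'R[x /RP[Px _]]]]; first by exists i.
  by apply/dom; exists x.
- move=> u v i Pi Pj eq_col; apply/eqP/negPn/negP => ne_uv.
  have [[x Rx] [y Ry]] := (P'R _ _ Pi, P'R _ _ Pj).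
  (* Equal entries in one column precede each other in neither direction, whereas distinct x and y
     would be comparable. *)
  have := Rne _ _ _ _ _ _ ne_uv Rx Ry.
  rewrite eq_sym in ne_uv; have := Rne _ _ _ _ _ _ ne_uv Ry Rx.
  have [[Px _] [Py _]] := (RP _ _ _ Rx, RP _ _ _ Ry).
  have neq_xy : x <> y by move=> eq; rewrite eq in Px; rewrite (col _ _ _ Px Py) ?eqxx in ne_uv.
  by rewrite /prec; lia.
- move=> r c i j /P'R[x Rx] /P'R[y Ry].
  rewrite -(Rne _ _ _ _ _ _ _ Ry Rx) 1?eq_sym //.
  by apply: row; [case: (RP _ _ _ Rx) | case: (RP _ _ _ Ry)].
- move=> r c t x y z tc /anchR[x1 ax Rx] /anchR[y1 ay Ry] /anchR[z1 az Rz].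
  have := triple _ _ _ _ _ _ tc ax ay az.
  by rewrite (Rne _ _ _ _ _ _ _ Rz Ry) ?(Rne _ _ _ _ _ _ _ Rx Rz) //;
    apply/eqP => E; move: tc; rewrite /third_cell -?E ?E /=; lia.
- move=> u v x y z /P'R[x1 Rx] /anchR[y1 ay Ry] /anchR[z1 az Rz] ne_uv eq_col.
  rewrite -(Rne _ _ _ _ _ _ ne_uv Rx Rz) -(Rne _ _ _ _ _ _ ne_uv Ry Rz) => lt_xz hr hl.
  have [Px _] := RP _ _ _ Rx.
  apply: (free u v x1) => //.
    move=> t /PR[i Rt]; rewrite (Rne _ _ _ _ _ _ _ Rt Rx); last first.
      by apply/eqP => E; move: eq_col; rewrite -E /=; lia.
    by apply: hr; case: (RP _ _ _ Rt).
  move=> c t eq_c /PR[i Rt]; rewrite (Rne _ _ _ _ _ _ _ Rx Rt); last first.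
    by apply/eqP => E; move: eq_col; rewrite E /=; lia.
  by apply: hl => //; case: (RP _ _ _ Rt).
- move=> r r' x y lt_r /anchR[x1 ax Rx] /anchR[y1 ay Ry].
  rewrite -(Rne _ _ _ _ _ _ _ Rx Ry); first exact: first.
  by apply/eqP => -[]; lia.
Qed.

Lemma eq_semistandard_on (P P' : cell -> pred nat) n :
  (forall u x, P u x -> x <= n) -> P =2 P' -> semistandard_on P -> semistandard_on P'.
Proof.
move=> bound eqP; apply: (semistandard_on_transfer (R := fun u x i => P u x /\ x = i) bound).
- by move=> u x _ [Px <-]; rewrite -eqP.
- by move=> u x Px; exists x.
- by move=> u x; rewrite -eqP => Px; exists x.
- by move=> u v x y _ _ _ [_ <-] [_ <-].
- by move=> u x y _ _ [_ <-] [_ <-] /ltnW.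
Qed.
End Abstract.

(** * Glides of a word of cells *)

(* In a word of length N the value k occupies the f k positions i with
   psum f r k - r k <= i < psum f r k.+1, the first of them being shared with a
   smaller value when r k holds; the values must increase strictly from position
   p - 1 to position p when p is in D. *)
Definition glides_on N (D : pred nat) n f r : Prop :=
  [/\ psum f r n = N, forall k, k < n -> r k -> 0 < f k /\ 0 < psum f r k
    & forall k p, k < n -> psum f r k - r k < p < psum f r k.+1 -> ~~ D p].

Definition gtcol (u v : cell) := v.2 < u.2.

Lemma gtcol_trans : transitive gtcol.
Proof. by move=> v u t; rewrite /gtcol; lia. Qed.

(** Equal values are read from right to left, so where the column fails to decrease the value must
    increase. *)
Definition descents (w : seq cell) : pred nat := fun p =>
  (0 < p < size w) && ((nth (0, 0) w p.-1).2 <= (nth (0, 0) w p).2).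

(** Positions of the word serve as entries: a standardization common to all fillings with this
    word. *)
Definition word_filling (w : seq cell) (u : cell) : pred nat := fun p =>
  (p < size w) && (nth (0, 0) w p == u).

Definition block_filling n (B : nat -> seq cell) (u : cell) : pred nat := fun k =>
  (k < n) && (u \in B k).

(** * From a glide of a word to a filling *)

Section Decode.
Variables (w : seq cell) (n : nat) (f : nat -> nat) (r : nat -> bool).
Hypothesis glw : glides_on (size w) (descents w) n f r.

Let A := psum f r.
Let B := glide_block w f r.

Let szA k : k <= n -> A k <= size w.
Proof. by case: glw => <- _ _ le_kn; apply: psum_mono. Qed.

Let red_gt0 k : k < n -> r k -> 0 < A k.
Proof. by case: glw => _ + _ => h /h{}h /h[]. Qed.

Lemma glide_block_col k i j : k < n -> A k - r k <= i -> i < j -> j < A k.+1 ->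
  (nth (0, 0) w j).2 < (nth (0, 0) w i).2.
Proof.
move=> lt_kn le_i; elim: j => // j IHj lt_ij ltj.
have [_ _ /(_ k j.+1 lt_kn)] := glw.
rewrite /descents -/A; have := szA lt_kn.
have : A k - r k < j.+1 < A k.+1 by lia.
move=> -> sz /(_ isT); have -> /= : j.+1 < size w by lia.
rewrite -ltnNge; case: (ltngtP i j) lt_ij IHj => [lt_ij _ /(_ isT (ltnW ltj))|lt|->]; lia.
Qed.

Lemma glide_block_sorted k : k < n -> sorted gtcol (B k).
Proof.
move=> lt_kn; apply/(sortedP (0, 0)) => i; rewrite size_slice ?szA // => lti.
rewrite /slice !nth_drop !nth_take; try (clear A B szA red_gt0 glw; lia).
by apply: (@glide_block_col k) => //; rewrite /A; clear A B szA red_gt0; lia.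
Qed.

(* The entry x of u is read at position i of w. *)
Let R u x i := [&& x < n, A x - r x <= i < A x.+1 & nth (0, 0) w i == u].

Let R_mono u v x y i j : R u x i -> R v y j -> x < y -> i <= j.
Proof.
move=> /and3P[ltx /andP[_ lti] _] /and3P[lty /andP[lej _] _] lt_xy.
have : A x.+1 <= A y by apply: psum_mono.
by case: (r y) lej => /=; lia.
Qed.

(** Distinct values are ordered like their blocks. Inside one block the columns strictly decrease,
    so positions follow the reading order of equal values. *)
Let Rprec u v x y i j : u != v -> R u x i -> R v y j -> prec u x v y = prec u i v j.
Proof.
move=> ne_uv Rx Ry; have hxy := R_mono Rx Ry; have hyx := R_mono Ry Rx.
move: Rx Ry => /and3P[ltx hi /eqP ui] /and3P[lty hj /eqP vj].
have ne_ij : i <> j by move=> eq_ij; rewrite -ui -vj eq_ij eqxx in ne_uv.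
rewrite /prec; case: (ltngtP x y) => [lt|lt|eq].
- by have := hxy lt; lia.
- by have := hyx lt; lia.
rewrite -{y}eq in lty hj hxy hyx *.
case: (ltngtP i j) => //= lt_ij.
  by rewrite -ui -vj (@glide_block_col x) //; lia.
by apply/negbTE; rewrite -leqNgt ltnW // -ui -vj (@glide_block_col x) //; lia.
Qed.

Let exists_value i : i < size w -> exists2 k, k < n & A k <= i < A k.+1.
Proof.
have [<- _ _] := glw; rewrite -/A; elim: n => [|k IHk]; first by rewrite /A /psum big_ord0.
case: (ltnP i (A k)) => [/IHk[k' ltk h] _|le_i lti]; last by exists k; rewrite ?le_i.
by exists k' => //; lia.
Qed.

Let R_sound u x i : R u x i -> block_filling n B u x /\ word_filling w u i.
Proof.
move=> /and3P[ltx hi /eqP ui].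
rewrite /block_filling /word_filling ltx ui eqxx andbT; split; last by have := szA ltx; lia.
by apply/(mem_slice (0,0)); [apply: szA | exists i].
Qed.

Let R_block u x : block_filling n B u x -> exists i, R u x i.
Proof.
move=> /andP[ltx /(mem_slice (0, 0) _ _ (szA ltx))[i hi ui]].
by exists i; rewrite /R ltx -/A hi ui eqxx.
Qed.

Let R_word u i : word_filling w u i -> exists x, R u x i.
Proof.
move=> /andP[/exists_value[k ltk hi] ui]; exists k; rewrite /R ltk ui.
by rewrite andbT /=; lia.
Qed.

(** Semistandardness depends on the word alone: [R] between values and positions meets the transfer
    conditions in both directions. *)
Lemma semistandard_glide_block alpha :
  semistandard_on alpha (block_filling n B) <-> semistandard_on alpha (word_filling w).
Proof.
split.
  apply: (@semistandard_on_transfer _ _ _ n R) => //; first by move=> u x /andP[/ltnW].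
  by move=> u x y i j; apply: R_mono.
apply: (@semistandard_on_transfer _ _ _ (size w) (fun u i x => R u x i)) => //.
- by move=> u x /andP[/ltnW].
- by move=> u i x /R_sound[].
- by move=> u v x y i j ne Rx Ry; rewrite (Rprec ne Rx Ry).
- move=> u x y i j Ri Rj lt_xy; rewrite leqNgt; apply/negP => lt_ji.
  by have := R_mono Rj Ri lt_ji; lia.
Qed.
End Decode.

(** * From a filling to a glide of its word *)

Section Encode.
Variables (B : nat -> seq cell) (n : nat).
Hypothesis B_sorted : forall k, k < n -> sorted gtcol (B k).

Lemma glides_on_merged :
  glides_on (size (merged (0, 0) B n)) (descents (merged (0, 0) B n)) n
    (size \o B) (red_at (0, 0) B).
Proof.
split; first by rewrite size_merged.
  by move=> k _ /and3P[A0 B0 _]; rewrite -size_merged.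
move=> k p ltk; rewrite -!size_merged => lt_p.
have le : size (merged (0, 0) B k.+1) <= size (merged (0, 0) B n).
  by rewrite !size_merged psum_mono.
have := B_sorted ltk; rewrite (merged_slice (0, 0) B ltk).
set lo := size _ - _ in lt_p *; set hi := size (merged _ _ k.+1) in lt_p le *.
move/(sortedP (0, 0))/(_ (p.-1 - lo)); rewrite size_slice //.
rewrite /slice !nth_drop !nth_take; try lia.
rewrite (_ : lo + (p.-1 - lo) = p.-1) 1?(_ : lo + (p.-1 - lo).+1 = p); try lia.
rewrite /gtcol /descents => h; rewrite negb_and -ltnNge h ?orbT //; lia.
Qed.

Lemma stutter_free_merged_sorted : stutter_free (merged (0, 0) B n).
Proof.
apply: stutter_free_merged => k /B_sorted; apply: sub_sorted => u v.
by apply: contraTneq => ->; rewrite /gtcol ltnn.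
Qed.

Lemma glide_block_merged k : k < n ->
  glide_block (merged (0, 0) B n) (size \o B) (red_at (0, 0) B) k = B k.
Proof. by move=> ltk; rewrite [RHS](merged_slice (0, 0) B ltk) /glide_block -!size_merged. Qed.

End Encode.

(** * Glides and cut points *)

(** The subset of {1, ..., |g| - 1} that corresponds to the composition [g]. *)
Definition part_sums (g : seq nat) : pred nat :=
  fun p => p \in [seq sumn (take j g) | j <- iota 1 (size g).-1].

(* The cut points i_0 < ... < i_l of a glide of g, padded with zeros on the
   left. *)
Definition cuts n (g : seq nat) (f : nat -> nat) (r : nat -> bool) (I : nat -> nat) : Prop :=
  [/\ I 0 = 0, forall k, I (size g) <= k < n -> f k = 0,
      forall k, k < n -> r k -> 0 < f k
    & forall j, j < size g ->
      [/\ I j < I j.+1, psum f r (I j.+1) = psum f r (I j) + nth 0 g j,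
          I j.+1 <= n - size g + j.+1
        & exists k, [/\ I j <= k < I j.+1, 0 < f k, ~~ r k
          & forall k', I j <= k' < k -> f k' = 0]]].

Lemma sumn_takeS (g : seq nat) j : j < size g ->
  sumn (take j.+1 g) = sumn (take j g) + nth 0 g j.
Proof. by move=> ltj; rewrite (take_nth 0) // sumn_rcons. Qed.

Section Cuts.
Variables (n : nat) (g : seq nat) (f : nat -> nat) (r : nat -> bool).
Hypothesis g_comp : is_composition g.

Let A := psum f r.
Let sg j := sumn (take j g).

Let AS k : A k.+1 = A k + (f k - r k). Proof. exact: psumS. Qed.
Let A0 : A 0 = 0. Proof. by rewrite /A /psum big_ord0. Qed.
Let Amono i j : i <= j -> A i <= A j. Proof. exact: psum_mono. Qed.
Let sgS j : j < size g -> sg j < sg j.+1.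
Proof.
by move=> ltj; rewrite /sg sumn_takeS // -addn1 leq_add2l; apply: (all_nthP 0 g_comp).
Qed.

(** At the cut points [psum] takes the partial sums of [g], and each block opens with a black value,
    so no value straddles a partial sum. *)
Lemma cuts_glides_on I : size g <= n -> cuts n g f r I ->
  glides_on (sumn g) (part_sums g) n f r.
Proof.
move=> le_gn [I0 f0 rf blk].
have AI j : j <= size g -> A (I j) = sg j.
  elim: j => [|j IHj] le_j; first by rewrite I0 A0 /sg take0.
  by have [_ e _ _] := blk _ le_j; rewrite /A e -/(A _) IHj 1?ltnW // /sg sumn_takeS.
have In : I (size g) <= n.
  case: (posnP (size g)) => [->|g_gt0]; first by rewrite I0.
  by have [|_ _ + _] := blk (size g).-1; rewrite ?prednK //; lia.
have An : A n = sumn g.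
  rewrite -[g in RHS]take_size -/(sg _) -AI //.
  have H d : I (size g) + d <= n -> A (I (size g) + d) = A (I (size g)).
    elim: d => [|d IHd]; rewrite ?addn0 // addnS => le_d.
    by rewrite AS IHd ?f0 //; lia.
  by have := H (n - I (size g)); rewrite subnKC //; apply.
split=> //.
  move=> k ltk rk; split; first exact: rf.
  have fk := rf _ ltk rk.
  case: (posnP (size g)) => [g0|g_gt0].
    by have := f0 k; rewrite g0 I0 ltk => /(_ isT); lia.
  (* The first nonzero value k0 is black, so the red k comes later and has a letter to share. *)
  have [_ _ _ [k0 [hk0 fk0 rk0 min0]]] := blk _ g_gt0.
  rewrite -/A; case: (ltngtP k k0) => [lt|lt|eq].
  - by have := min0 k; rewrite I0 lt => /(_ isT); lia.
  - by have := Amono lt; rewrite AS (negPf rk0); lia.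
  - by rewrite -eq rk in rk0.
move=> k p ltk; rewrite -/A => hp; apply/negP => /mapP[j]; rewrite mem_iota => hj ep.
have ltj : j < size g by lia.
(* Suppose p is the j-th partial sum. Then k is not before block j, whose first nonzero value k0 is
   black: k < k0 has no letters, k = k0 starts at p or later, and k > k0 starts at p or later even
   if it is red. *)
have [_ _ _ [k0 [hk0 fk0 rk0 min0]]] := blk _ ltj.
have := AI j (ltnW ltj); rewrite /sg -ep => AIj.
have le_Ij : I j <= k.
  by rewrite leqNgt; apply/negP => /Amono; rewrite AIj; lia.
have fk : 0 < f k by case E: (r k); [apply: rf | move: hp; rewrite AS E /=; lia].
case: (ltngtP k k0) => [lt|lt|eq].
- by have := min0 k; rewrite le_Ij lt => /(_ isT); lia.
- have := Amono lt; rewrite AS (negPf rk0).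
  by have /andP[/Amono + _] := hk0; move: hp; case: (r k) => /=; lia.
- by move: hp; rewrite eq (negPf rk0) -eq; have := Amono le_Ij; lia.
Qed.

Lemma glides_on_cuts : glides_on (sumn g) (part_sums g) n f r ->
  size g <= n /\ exists I, cuts n g f r I.
Proof.
move=> [An red_ok D_ok]; rewrite -/A in An red_ok D_ok.
(* [I j] is the first value occupying position [sg j], where block j begins. The case j = 0 puts
   leading zeros into the first block; for j = size g > 0 the search fails and returns n. *)
pose I j := if j == 0 then 0 else find (fun k => sg j < A k.+1) (iota 0 n).
have In j : I j <= n.
  by rewrite /I; case: eqP => // _; rewrite -[n in _ <= n](size_iota 0) find_size.
have sg_lt j : j < size g -> sg j < sumn g.
  move=> ltj; rewrite -[in X in _ < X](cat_take_drop j g) sumn_cat -[X in X < _]addn0 ltn_add2l.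
  rewrite (drop_nth 0) //=; have : 0 < nth 0 g j by apply: (all_nthP 0 g_comp).
  by lia.
have sgg : sg (size g) = sumn g by rewrite /sg take_size.
have I_before j k : 0 < j -> k < I j -> A k.+1 <= sg j.
  move=> j0 ltk; have ltkn := leq_trans ltk (In j).
  move: ltk; rewrite /I; case: eqP j0 => [-> //|_ _] /(before_find 0).
  by rewrite nth_iota // add0n => /negbT; rewrite -leqNgt.
have cut j : 0 < j < size g -> [/\ I j < n, A (I j) = sg j, ~~ r (I j) & 0 < f (I j)].
  move=> /andP[j0 ltj].
  have n0 : 0 < n.
    rewrite lt0n; apply/eqP => n0; have := sg_lt _ ltj; rewrite -An n0 A0; lia.
  have hasI : has (fun k => sg j < A k.+1) (iota 0 n).
    apply/hasP; exists n.-1; first by rewrite mem_iota; lia.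
    by rewrite prednK // An sg_lt.
  have ltI : I j < n.
    by move: hasI; rewrite has_find size_iota /I; case: eqP j0 => [->|].
  have lt_s : sg j < A (I j).+1.
    have := nth_find 0 hasI; rewrite nth_iota //; first by rewrite add0n /I; case: eqP j0 => [->|].
    by move: hasI; rewrite has_find size_iota.
  have le_s : A (I j) <= sg j.
    case E: (I j) => [|k]; first by rewrite A0.
    by apply: I_before; rewrite ?E.
  have Dj : part_sums g (sg j) by apply/mapP; exists j => //; rewrite mem_iota; lia.
  (* As [sg j] lies in [part_sums g], it cannot be strictly inside the range of [I j]; with [le_s]
     this forces equality and a black value. *)
  have := D_ok (I j) (sg j) ltI; rewrite lt_s andbT Dj; case: ltnP => [_ /(_ isT)//|ge_s _].
  have := red_ok (I j) ltI; case E: (r (I j)) ge_s => /= ge_s h.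
    by have [] := h isT; lia.
  split=> //; first by lia.
  by move: lt_s; rewrite AS E; lia.
have Ig : 0 < size g -> I (size g) = n.
  move=> g0; apply/eqP; rewrite eqn_leq In /I -[size g == 0]negbK -lt0n g0 /=.
  rewrite -[X in X <= _](size_iota 0 n).
  rewrite leqNgt -has_find -all_predC; apply/allP => k; rewrite mem_iota /= sgg -An => ltk.
  by rewrite -leqNgt Amono.
have AI j : j <= size g -> A (I j) = sg j.
  rewrite leq_eqVlt => /predU1P[->|ltj]; last first.
    case: (posnP j) => [->|j0]; first by rewrite /I /= A0 /sg take0.
    by have [] := cut j _; rewrite ?j0.
  case: (posnP (size g)) => [->|g0]; first by rewrite /I /= A0 /sg take0.
  by rewrite Ig // An.
have Ilt j : j < size g -> I j < I j.+1.
  move=> ltj; rewrite ltnNge; apply/negP => /Amono.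
  by rewrite (AI _ ltj) (AI _ (ltnW ltj)) leqNgt sgS.
(* The cut points strictly increase and end at or before n. This yields [size g <= n], and the upper
   bounds on the cut points, which are the loosest possible because [g] is padded on the left. *)
have Ibound d : d <= size g -> I (size g - d) + d <= n.
  elim: d => [|d IHd] le_d; first by rewrite subn0 addn0.
  have := IHd (ltnW le_d); have := Ilt (size g - d.+1).
  have -> : (size g - d.+1).+1 = size g - d by lia.
  by lia.
have le_gn : size g <= n by have := Ibound _ (leqnn _); rewrite subnn /I; lia.
split=> //; exists I; split=> //.
- move=> k; case: (posnP (size g)) => [g0|g_gt0].
    have n0 : sumn g = 0 by rewrite (size0nil g0).
    move=> /andP[_ ltk]; have := Amono ltk; have := red_ok _ ltk.
    by rewrite AS An n0; case: (r k) => [/(_ isT)[]|_]; lia.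
  by rewrite Ig //; lia.
- by move=> k ltk /(red_ok _ ltk)[].
- move=> j ltj; split.
  + exact: Ilt.
  + by rewrite -/A (AI _ ltj) (AI _ (ltnW ltj)) /sg sumn_takeS.
  + by have := Ibound (size g - j.+1); rewrite subKn //; lia.
  + case: (posnP j) => [j0|j0]; last first.
      have [//|ltI _ nr f0] := cut j; first by rewrite j0.
      by exists (I j); split=> //; [rewrite Ilt ?leqnn | lia].
    (* The first block may begin with zeros; its first nonzero value cannot be red, as no letter
       precedes it. *)
    rewrite {}j0 in ltj *.
    have hasf : has (fun k => 0 < f k) (iota 0 (I 1)).
      apply/negPn; rewrite -all_predC; apply/negP => /allP f0.
      have : A (I 1) = 0.
        elim: (I 1) f0 => // i IHi f0; rewrite AS IHi ?add0n.
          by have := f0 i; rewrite mem_iota /= ltnS leqnn -leqNgt => /(_ isT); lia.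
        by move=> k hk; apply: f0; move: hk; rewrite !mem_iota; lia.
      by rewrite AI //; have := sgS ltj; lia.
    have := hasf; rewrite has_find size_iota => ltk0.
    have := nth_find 0 hasf; rewrite nth_iota // add0n => fk0.
    have f0 k : k < find (fun k => 0 < f k) (iota 0 (I 1)) -> f k = 0.
      move=> ltk; have := before_find 0 ltk; rewrite nth_iota; last by lia.
      by rewrite add0n lt0n => /negbFE/eqP.
    exists (find (fun k => 0 < f k) (iota 0 (I 1))); split=> //.
    have Ak0 k : k <= find (fun k => 0 < f k) (iota 0 (I 1)) -> A k = 0.
      by elim: k => // k IHk ltk; rewrite AS IHk 1?ltnW // f0.
    apply/negP => /red_ok[]; first by have := In 1; lia.
    by rewrite Ak0.
Qed.
End Cuts.

Section Glides.
Variable n : nat.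
Implicit Types (a m : 'X_{1..n}) (red : {set 'I_n}).

Definition multn m k := if insub k is Some i then m i else 0.
Definition redn red k := if insub k is Some i then i \in red else false.

Lemma multnE m (i : 'I_n) : multn m i = m i. Proof. by rewrite /multn valK. Qed.
Lemma rednE red (i : 'I_n) : redn red i = (i \in red). Proof. by rewrite /redn valK. Qed.

Lemma val_positive_positions a :
  map val (positive_positions a) = [seq k <- iota 0 n | 0 < multn a k].
Proof.
rewrite /positive_positions -val_enum_ord filter_map; congr map.
by apply: eq_filter => i; rewrite /= multnE.
Qed.

Variable g : seq nat.
Hypotheses (g_comp : is_composition g) (le_gn : size g <= n).

Lemma positive_positions_pad :
  map val (positive_positions (pad_left n g)) = iota (n - size g) (size g).
Proof.
have multE k : k < n -> multn (pad_left n g) k = nth 0 (nseq (n - size g) 0 ++ g) k.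
  by move=> ltk; rewrite -[k in LHS]/(nat_of_ord (Ordinal ltk)) multnE mnmE.
have -> : map val (positive_positions (pad_left n g)) =
    [seq k <- iota 0 (n - size g) ++ iota (n - size g) (size g) | 0 < multn (pad_left n g) k].
  by rewrite val_positive_positions; have := iotaD 0 (n - size g) (size g); rewrite subnK // => ->.
rewrite filter_cat.
rewrite (eq_in_filter (a2 := pred0)) ?filter_pred0; last first.
  move=> k; rewrite mem_iota => hk; rewrite multE; last by lia.
  by rewrite nth_cat size_nseq nth_nseq !ifT //; lia.
rewrite (eq_in_filter (a2 := predT)) ?filter_predT // => k; rewrite mem_iota => hk.
rewrite multE; last by lia.
rewrite nth_cat size_nseq ifF; last by lia.
by apply: (all_nthP 0 g_comp); lia.
Qed.

Lemma size_positive_positions_pad : size (positive_positions (pad_left n g)) = size g.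
Proof. by rewrite -(size_map val) positive_positions_pad size_iota. Qed.

Lemma tnth_positive_positions_pad j :
  tnth (in_tuple (positive_positions (pad_left n g))) j = n - size g + j :> nat.
Proof.
have ltj : j < size g by case: j => j; rewrite /= size_positive_positions_pad.
set p := in_tuple _; rewrite -[LHS]/(val _) (tnth_nth (tnth p j)) /=.
rewrite -(nth_map (tnth p j) 0 val) ?size_positive_positions_pad //.
by rewrite positive_positions_pad nth_iota.
Qed.

Lemma pad_left_tnth j :
  pad_left n g (tnth (in_tuple (positive_positions (pad_left n g))) j) = nth 0 g j.
Proof.
by rewrite mnmE nth_cat size_nseq [X in X < _]tnth_positive_positions_pad ltnNge leq_addr
  /= tnth_positive_positions_pad addKn.
Qed.

(** The additive form avoids subtracting sums; red entries are positive, so the truncated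
    differences in [psum] are exact. *)
Lemma psum_block m red lo hi : is_weak_komposition m red -> lo <= hi <= n ->
  psum (multn m) (redn red) hi + #|red :&: block n lo hi| =
  psum (multn m) (redn red) lo + \sum_(k in block n lo hi) m k.
Proof.
move=> /forall_inP wk /andP[le_lh le_hn].
rewrite /psum (big_ord_widen n (fun i => multn m i - redn red i)) //.
rewrite (big_ord_widen n (fun i => multn m i - redn red i) (leq_trans le_lh le_hn)).
rewrite (bigID (fun i : 'I_n => i < lo)) /= -addnA; congr (_ + _).
  by apply: eq_bigl => i; lia.
rewrite [X in X + _](eq_bigl (mem (block n lo hi))); last by move=> i; rewrite !inE; lia.
have -> : #|red :&: block n lo hi| = \sum_(i in block n lo hi) (i \in red).
  rewrite -sum1_card big_mkcond [RHS]big_mkcond; apply: eq_bigr => i _ /=.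
  by rewrite in_setI; case: (i \in red); case: (i \in block n lo hi).
rewrite -big_split /=; apply: eq_bigr => i _; rewrite multnE rednE.
by case: (boolP (i \in red)) => [/wk|_] /=; lia.
Qed.

(** The parts of the padded composition occupy the last [size g] positions, which makes the bound
    i_j <= n_j explicit. *)
Lemma is_glide_cuts m red :
  is_glide (pad_left n g) m red <->
  exists I, cuts n g (multn m) (redn red) I.
Proof.
set p := positive_positions (pad_left n g).
have szp : size p = size g := size_positive_positions_pad.
split.
  case/andP => wk /existsP[i /and3P[/eqP i0 /forallP izero /forallP iblk]].
  have rf k : k < n -> redn red k -> 0 < multn m k.
    move=> ltk; rewrite -[k]/(nat_of_ord (Ordinal ltk)) multnE rednE.
    by move/forall_inP: wk; apply.
  exists (fun j => nat_of_ord (i (inord j))); split=> //.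
  - by have -> // : inord 0 = ord0 :> 'I_(size p).+1 by apply: val_inj; rewrite /= inordK.
  - have -> : inord (size g) = ord_max :> 'I_(size p).+1 by apply: val_inj; rewrite /= inordK szp.
    move=> k /andP[le_k ltk].
    have /implyP := izero (Ordinal ltk); rewrite -multnE /= => h.
    by apply/eqP/h.
  move=> j ltj /=.
  have ltjp : j < size p by rewrite szp.
  have := iblk (Ordinal ltjp).
  have -> : widen_ord (leqnSn (size p)) (Ordinal ltjp) = inord j.
    by apply: val_inj; rewrite /= inordK // ltnS ltnW.
  have -> : lift ord0 (Ordinal ltjp) = inord j.+1.
    by apply: val_inj; rewrite /= inordK.
  cbv zeta; rewrite pad_left_tnth tnth_positive_positions_pad => /and4P[lt_i /eqP sum_eq le_i].
  case/exists_inP=> k; rewrite inE => hk /and3P[mk rk /forall_inP zk].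
  split=> //.
  - have hn : i (inord j) <= i (inord j.+1) <= n by rewrite (ltnW lt_i) -ltnS ltn_ord.
    by apply: (@addIn #|red :&: block n (i (inord j)) (i (inord j.+1))|);
      rewrite psum_block // -addnA sum_eq.
  - by rewrite addnS; exact: le_i.
  - exists k; split=> //; rewrite ?multnE ?rednE // => k' hk'.
    have ltk' : k' < n by have := ltn_ord k; lia.
    have in_blk : Ordinal ltk' \in block n (i (inord j)) (i (inord j.+1)).
      by rewrite inE /=; case/andP: hk' => -> lt; case/andP: hk => _ /(ltn_trans lt)->.
    have /implyP/(_ _)/eqP := zk _ in_blk; rewrite -multnE; apply.
    by case/andP: hk'.
case=> I [I0 f0 rf blk].
have wk : is_weak_komposition m red.
  by apply/forall_inP => k rk; rewrite -multnE rf // rednE.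
have In j : j <= size g -> I j <= n.
  by case: j => [|j] le_j; [rewrite I0 | have [_ _ + _] := blk _ le_j; lia].
apply/andP; split=> //; apply/existsP.
exists [ffun j : 'I_(size p).+1 => inord (I j) : 'I_n.+1].
have iE (j : 'I_(size p).+1) : j <= size g -> (inord (I j) : 'I_n.+1) = I j :> nat.
  by move=> le_j; rewrite inordK // ltnS In.
apply/and3P; split.
- by rewrite ffunE iE // I0.
- apply/forallP => k; apply/implyP; rewrite ffunE iE /= -/p ?szp // => le_k.
  by rewrite -multnE f0 // le_k ltn_ord.
apply/forallP => j; cbv zeta; have ltj : j < size g by rewrite -szp ltn_ord.
rewrite pad_left_tnth tnth_positive_positions_pad !ffunE !iE //=; last exact: ltnW.
have [lt_I eqA le_I [k [hk fk rk zk]]] := blk _ ltj.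
have ltk : k < n by have := In _ ltj; lia.
apply/and4P; split=> //.
- have hn : I j <= I j.+1 <= n by rewrite (ltnW lt_I) In.
  by have := psum_block wk hn; rewrite /bump /= add1n eqA => h; apply/eqP; lia.
- by rewrite /bump /= add1n; lia.
apply/exists_inP; exists (Ordinal ltk); first by rewrite inE /= /bump /= add1n.
rewrite -multnE -rednE fk rk /=; apply/forall_inP => k'; rewrite inE => hk'.
by apply/implyP => lt_k'; rewrite -multnE zk //; lia.
Qed.
End Glides.

(** * The composition of a word *)

Definition gaps x (s : seq nat) := pairmap (fun y z => z - y) x s.

(** The composition gamma(w). The empty word is separate because the gaps would otherwise be the
    single part 0. *)
Definition run_lengths (w : seq cell) : seq nat :=
  if w is [::] then [::] else
  gaps 0 (rcons [seq p <- iota 1 (size w).-1 | descents w p] (size w)).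

Lemma gaps_composition x s : path ltn x s -> is_composition (gaps x s).
Proof.
by elim: s x => //= y s IHs x /andP[lt_xy /IHs->]; rewrite subn_gt0 lt_xy.
Qed.

Lemma sumn_take_gaps x s j : path leq x s -> j < size s ->
  x + sumn (take j.+1 (gaps x s)) = nth 0 s j.
Proof.
elim: s x j => //= y s IHs x j /andP[le_xy ps]; rewrite addnA subnKC //.
by case: j => [_|j /(IHs _ _ ps)]; first by rewrite take0 addn0.
Qed.

Section Runs.
Variable w : seq cell.

Let ds := rcons [seq p <- iota 1 (size w).-1 | descents w p] (size w).

Let path_ds : w != [::] -> path ltn 0 ds.
Proof.
move=> w0; have sz : 0 < size w by case: w w0.
have srt : sorted ltn [seq p <- iota 1 (size w).-1 | descents w p].
  by apply: sorted_filter; [apply: ltn_trans | apply: iota_ltn_sorted].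
rewrite rcons_path path_min_sorted ?srt /=; last first.
  by apply/allP => p; rewrite mem_filter mem_iota => /and3P[].
have := mem_last 0 [seq p <- iota 1 (size w).-1 | descents w p].
rewrite inE => /predU1P[->//|]; rewrite mem_filter mem_iota => /and3P[_ _].
by rewrite add1n prednK.
Qed.

Lemma run_lengths_composition : is_composition (run_lengths w).
Proof.
rewrite /run_lengths -/ds; case: w path_ds => //= u v h.
exact/gaps_composition/h.
Qed.

Let sumn_take_runs j : w != [::] -> j < size ds ->
  sumn (take j.+1 (run_lengths w)) = nth 0 ds j.
Proof.
move=> w0 ltj; rewrite -(sumn_take_gaps _ ltj (x := 0)) ?add0n.
  by rewrite /run_lengths -/ds; case: w w0.
by apply: sub_path (path_ds w0) => x y /ltnW.
Qed.

Let size_runs : w != [::] -> size (run_lengths w) = size ds.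
Proof. by rewrite /run_lengths -/ds; case: w => // u v _; rewrite /gaps size_pairmap. Qed.

Lemma sumn_run_lengths : sumn (run_lengths w) = size w.
Proof.
have [->//|w0] := eqVneq w [::].
have ds0 : (size ds).-1 < size ds by rewrite size_rcons.
have := sumn_take_runs w0 ds0; rewrite prednK ?size_rcons //.
rewrite take_oversize ?size_runs ?size_rcons // => ->.
by rewrite nth_rcons /= ltnn eqxx.
Qed.

Lemma part_sums_run_lengths : part_sums (run_lengths w) =1 descents w.
Proof.
move=> p; have [->|w0] := eqVneq w [::]; first by rewrite /descents /part_sums /= andbF.
rewrite /part_sums (_ : map _ _ = [seq q <- iota 1 (size w).-1 | descents w q]).
  by rewrite mem_filter mem_iota andb_idr // => /andP[h _]; lia.
rewrite size_runs // size_rcons /=.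
set s := filter _ _; rewrite -[RHS](mkseq_nth 0) /mkseq (iotaDl 1 0) -map_comp.
apply/eq_in_map => j; rewrite mem_iota /= add0n => ltj.
rewrite add1n sumn_take_runs ?nth_rcons -/s ?ltj // size_rcons -/s ltnW //.
Qed.
End Runs.

(** * Coefficients of multifundamental polynomials *)

Import GRing.Theory Num.Theory.

Section GlideList.
Variables (N : nat) (D : pred nat).

Fixpoint glides_list a (l : seq (nat * bool)) : Prop :=
  if l is (k, b) :: l' then
    [/\ b -> 0 < k /\ 0 < a, forall p, a - b < p < a + (k - b) -> ~~ D p
      & glides_list (a + (k - b)) l']
  else a = N.

(** A zero entry is not red and consumes no letter. So only the positive entries matter, which is
    the source of quasisymmetry. *)
Lemma glides_list_filter a l : all (fun kb => kb.2 ==> (0 < kb.1)) l ->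
  glides_list a l <-> glides_list a [seq kb <- l | 0 < kb.1].
Proof.
elim: l a => //= -[k b] l IHl a /andP[/= bk /IHl IH].
case: (posnP k) bk => [->|k0 _] /=; last first.
  by split=> -[h1 h2 /IH h3]; split=> // /h1[].
case: b => //= _; rewrite addn0 -IH; split=> [[]//|gl]; split=> // p; lia.
Qed.

Lemma glides_onP n f r :
  glides_on N D n f r <-> glides_list 0 [seq (f k, r k) | k <- iota 0 n].
Proof.
suff H t s : glides_list (psum f r s) [seq (f k, r k) | k <- iota s t] <->
    [/\ psum f r (s + t) = N,
        forall k, s <= k < s + t -> r k -> 0 < f k /\ 0 < psum f r k
      & forall k p, s <= k < s + t -> psum f r k - r k < p < psum f r k.+1 -> ~~ D p].
  by have := H n 0; rewrite add0n /psum big_ord0 => ->; split.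
elim: t s => [|t IHt] s.
  by rewrite addn0; split=> [gl|[]//]; split=> // k; lia.
rewrite /= -psumS -addSnnS; split=> [[rs Ds /IHt[An rk Dk]]|[An rk Dk]]; split=> //.
- by move=> k hk; have [<-//|ne] := eqVneq s k; apply: rk; lia.
- move=> k p hk; have [<-|ne] := eqVneq s k; first exact: Ds.
  by apply: Dk; lia.
- by apply: rk; lia.
- by move=> p; apply: Dk; lia.
- by apply/IHt; split=> // [k|k p] hk; [apply: rk | apply: Dk]; lia.
Qed.
End GlideList.

Section Coefficients.
Variable n : nat.
Implicit Types (m : 'X_{1..n}) (red : {set 'I_n}) (g : seq nat).

Lemma glides_on_mdeg N D m red :
  glides_on N D n (multn m) (redn red) -> mdeg m = N + #|red|.
Proof.
move=> [<- rk _]; rewrite mdegE -sum1_card (big_mkcond (fun i => i \in red)) /psum -big_split /=.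
apply: eq_bigr => i _; rewrite multnE rednE; have := rk i (ltn_ord i).
by rewrite multnE rednE; case: (i \in red) => [/(_ isT)[]|_] /=; lia.
Qed.

Lemma mdeg_pad_left g : size g <= n -> mdeg (pad_left n g) = sumn g.
Proof.
move=> le_gn; rewrite mdegE.
have -> : sumn g = sumn (nseq (n - size g) 0 ++ g).
  by rewrite sumn_cat sumn_nseq mul0n.
rewrite sumnE (big_nth 0) size_cat size_nseq subnK // big_mkord.
by apply: eq_bigr => i _; rewrite mnmE.
Qed.

Variables (g : seq nat) (g_comp : is_composition g).

Lemma is_glideP m red : size g <= n ->
  is_glide (pad_left n g) m red <->
  glides_on (sumn g) (part_sums g) n (multn m) (redn red).
Proof.
move=> le_gn; rewrite is_glide_cuts //; split=> [[I]|/(glides_on_cuts g_comp)[]//].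
exact: cuts_glides_on.
Qed.

Lemma mcoeff_glide_poly m : size g <= n ->
  ((glide_poly (pad_left n g))@_m =
  \sum_(red | is_glide (pad_left n g) m red) 'X^#|red|)%R.
Proof.
move=> le_gn; rewrite /glide_poly raddf_sum /=.
rewrite -(pair_big_dep xpredT (fun (b : bmultinom _ _) red => is_glide (pad_left n g) b red)
  (fun (b : bmultinom _ _) red => (('X^#|red| : {poly int}) *: 'X_[b])@_m)%R) /=.
have coef0 (b : 'X_{1..n < (mdeg (pad_left n g) + n).+1}) : bmnm b != m ->
    (\sum_(red | is_glide (pad_left n g) b red)
       (('X^#|red| : {poly int}) *: 'X_[bmnm b])@_m = 0)%R.
  by move=> /negPf ne; apply: big1 => red _; rewrite mcoeffZ mcoeffX ne mulr0.
case: (ltnP (mdeg m) (mdeg (pad_left n g) + n).+1) => [lt_m|ge_m].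
  rewrite (bigD1 (BMultinom lt_m)) //= [X in (_ + X)%R]big1 ?addr0.
    by apply: eq_bigr => red _; rewrite mcoeffZ mcoeffX eqxx mulr1.
  by move=> b ne; apply: coef0; rewrite -val_eqE in ne.
(* Beyond the degree bound both sides vanish: a glide has degree [sumn g + #|red|], hence at most
   [sumn g + n]. *)
rewrite big1 => [|b _]; last first.
  by apply: coef0; apply: contraTneq ge_m => <-; rewrite -ltnNge bmdeg.
rewrite big_pred0 // => red; apply/negbTE/negP => /(is_glideP _ _ le_gn)/glides_on_mdeg.
have : #|red| <= n by have := max_card red; rewrite card_ord.
by rewrite -(mdeg_pad_left le_gn); lia.
Qed.

(** Moves [red] along the bijection from the t-th element of [p] to the t-th element of [q]. *)
Definition relabel (p q : seq 'I_n) red : {set 'I_n} :=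
  [set i in q | nth i p (index i q) \in red].

Lemma relabelK p q red : uniq p -> uniq q -> size p = size q ->
  {subset red <= p} -> relabel q p (relabel p q red) = red.
Proof.
move=> up uq sz sub; apply/setP => i; rewrite !inE; case: (boolP (i \in p)) => [ip|ip]; last first.
  by apply/esym/negbTE; apply: contra ip => /sub.
have lti : index i p < size q by rewrite -sz index_mem.
by rewrite mem_nth //= index_uniq // (set_nth_default i) ?nth_index // sz.
Qed.

Lemma card_relabel p q red : uniq p -> uniq q -> size p = size q ->
  {subset red <= p} -> #|relabel p q red| = #|red|.
Proof.
move=> up uq sz sub.
suff <- : [set nth i q (index i p) | i in red] = relabel p q red.
  rewrite card_in_imset // => i j ir jr.
  have [lti ltj] : index i p < size q /\ index j p < size q.
    by rewrite -sz !index_mem !sub.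
  rewrite [RHS](set_nth_default i) // => /eqP; rewrite nth_uniq // => /eqP eq_ij.
  by rewrite -[i](nth_index i (sub _ ir)) eq_ij nth_index // sub.
apply/setP => k; rewrite !inE; apply/imsetP/andP => [[i ir ->]|[kq kr]].
  have lti : index i p < size q by rewrite -sz index_mem sub.
  by rewrite mem_nth // index_uniq // (set_nth_default i) ?nth_index ?sub // sz.
exists (nth k p (index k q)) => //; rewrite index_uniq ?sz ?index_mem //.
by rewrite (set_nth_default k) ?nth_index // index_mem.
Qed.

Lemma glides_on_positive N D m red :
  glides_on N D n (multn m) (redn red) <->
  {subset red <= positive_positions m} /\
  glides_list N D 0 (zip (positive_part m) [seq i \in red | i <- positive_positions m]).
Proof.
have filt : [seq kb <- [seq (multn m k, redn red k) | k <- iota 0 n] | 0 < kb.1] =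
    zip (positive_part m) [seq i \in red | i <- positive_positions m].
  rewrite zip_map -val_enum_ord -map_comp filter_map /positive_positions.
  rewrite (eq_filter (a2 := fun i => 0 < m i)); last by move=> i; rewrite /= multnE.
  by apply: eq_map => i; rewrite /= multnE rednE.
have sub_all : {subset red <= positive_positions m} ->
    all (fun kb => kb.2 ==> (0 < kb.1)) [seq (multn m k, redn red k) | k <- iota 0 n].
  move=> sub; rewrite -val_enum_ord -map_comp; apply/allP => _ /mapP[i _ ->] /=.
  by rewrite multnE rednE; apply/implyP => /sub; rewrite mem_filter => /andP[].
split=> [gl|[sub]].
  have sub : {subset red <= positive_positions m}.
    move=> i; have [_ /(_ i (ltn_ord i)) + _] := gl; rewrite rednE multnE => h /h[m0 _].
    by rewrite mem_filter m0 mem_enum.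
  by split=> //; rewrite -filt; apply/(glides_list_filter _ _ _ (sub_all sub))/glides_onP.
by rewrite -filt => /(glides_list_filter _ _ _ (sub_all sub))/glides_onP.
Qed.

Lemma glides_on_relabel N D m1 m2 red :
  positive_part m1 = positive_part m2 ->
  glides_on N D n (multn m1) (redn red) ->
  glides_on N D n (multn m2)
    (redn (relabel (positive_positions m1) (positive_positions m2) red)).
Proof.
move=> eq_pos /glides_on_positive[sub gl]; apply/glides_on_positive; split.
  by move=> i; rewrite inE => /andP[].
rewrite -eq_pos.
suff <- : [seq i \in red | i <- positive_positions m1] =
    [seq i \in relabel (positive_positions m1) (positive_positions m2) red
    | i <- positive_positions m2] by [].
have sz := congr1 size eq_pos; rewrite !size_map in sz.
have uq : uniq (positive_positions m2) by rewrite filter_uniq ?enum_uniq.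
apply: (@eq_from_nth _ false) => [|t]; rewrite !size_map // => ltt.
have [i0 _] : exists i0, i0 \in positive_positions m1.
  by case: positive_positions ltt => // i0 s _; exists i0; rewrite mem_head.
rewrite (nth_map i0) // (nth_map i0) -?sz // inE mem_nth -?sz //=.
by rewrite index_uniq -?sz // [X in _ = (X \in red)](set_nth_default i0).
Qed.

(** Relabelling red positions along the positive positions is a bijection between the glides with
    exponents m1 and m2, and it preserves the number of red entries. *)
Lemma is_quasisymmetric_multifundamental : is_quasisymmetric (multifundamental n g).
Proof.
move=> m1 m2 eq_pos; rewrite /multifundamental; case: ifP => [le_gn|]; last by rewrite !mcoeff0.
rewrite !mcoeff_glide_poly //.
set p := positive_positions m1; set q := positive_positions m2.
have [up uq] : uniq p /\ uniq q by split; apply/filter_uniq/enum_uniq.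
have sz : size p = size q by have := congr1 size eq_pos; rewrite !size_map.
have sub m red : is_glide (pad_left n g) m red -> {subset red <= positive_positions m}.
  move=> /andP[/forall_inP wk _] i /wk; by rewrite mem_filter mem_enum andbT.
have glP m1' m2' red : positive_part m1' = positive_part m2' ->
    is_glide (pad_left n g) m1' red -> is_glide (pad_left n g) m2'
      (relabel (positive_positions m1') (positive_positions m2') red).
  by move=> eq12 /is_glideP-/(_ le_gn) h; apply/is_glideP => //; apply: glides_on_relabel.
rewrite (reindex_onto (relabel q p) (relabel p q)); last first.
  by move=> red /sub h; rewrite relabelK.
apply: eq_big => [red|red /andP[h /eqP eq_red]].
  apply/andP/idP => [[/(glP _ m2) + /eqP eq_red]|h].
    by rewrite -/p -/q eq_red; apply.
  by rewrite relabelK //; [split=> //; apply: glP | apply: sub h].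
by rewrite card_relabel // => i; rewrite -eq_red inE => /andP[].
Qed.
End Coefficients.

(** * Fillings as relations between cells and entries *)

Section Fillings.
Variables (n : nat) (a : 'X_{1..n}).
Implicit Types (u v w : box a) (F : filling a) (c : cell).

Let p := positive_positions a.

Definition cell_of u : cell := (index (box_row u) p, box_col u).

Lemma mem_positive_positions (i : 'I_n) : (i \in positive_positions a) = (0 < a i).
Proof. by rewrite mem_filter mem_enum andbT. Qed.

Lemma positive_positions_uniq : uniq (positive_positions a).
Proof. exact/filter_uniq/enum_uniq. Qed.

Lemma positive_positions_sorted : sorted (fun i j : 'I_n => i < j) (positive_positions a).
Proof.
apply: sorted_filter; first by move=> ? ? ?; apply: ltn_trans.
by have := iota_ltn_sorted 0 n; rewrite -val_enum_ord sorted_map.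
Qed.

Lemma box_row_pos u : box_row u \in p.
Proof. by rewrite mem_positive_positions; case: u => i [c /=]; lia. Qed.

Lemma nth_positive_part (i : 'I_n) : i \in p -> nth 0 (positive_part a) (index i p) = a i.
Proof. by move=> ip; rewrite (nth_map i) ?index_mem // nth_index. Qed.

Lemma index_positive_ltn (i j : 'I_n) : i \in p -> j \in p -> (index i p < index j p) = (i < j).
Proof.
have h := sorted_ltn_index (fun x y z : 'I_n => @ltn_trans x y z) positive_positions_sorted.
move=> ip jp; apply/idP/idP => [|lt_ij]; first exact: h.
rewrite ltnNge leq_eqVlt; apply/negP => /predU1P[eq|/(h _ _ jp ip)]; last by lia.
by have := congr1 (nth i p) eq; rewrite !nth_index // => e; rewrite e ltnn in lt_ij.
Qed.

Lemma cell_of_inj : injective cell_of.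
Proof.
move=> u v [eq_i eq_c]; have := congr1 (nth (box_row u) p) eq_i.
rewrite !nth_index ?box_row_pos //.
case: u v eq_c {eq_i} => i c [j d] /= eq_c eq_ij; rewrite /= in eq_ij; subst j.
by congr Tagged; apply: val_inj.
Qed.

Lemma cell_of_col u : (cell_of u).2 < nth 0 (positive_part a) (cell_of u).1.
Proof. by rewrite /= nth_positive_part ?box_row_pos //; case: u => i c; apply: ltn_ord. Qed.

Lemma cell_of_surj c : c.2 < nth 0 (positive_part a) c.1 -> exists u, cell_of u = c.
Proof.
case: c => r c /= ltc.
have ltr : r < size p by rewrite ltnNge; apply/negP => le; rewrite nth_default ?size_map in ltc.
have [i0 _] : exists i0, i0 \in p by case: p ltr => // i0 s _; exists i0; rewrite mem_head.
rewrite (nth_map i0) // in ltc.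
exists (Tagged (fun i => 'I_(a i)) (Ordinal ltc)).
by congr pair; rewrite /= index_uniq ?positive_positions_uniq.
Qed.

Lemma adjacent_cell u v : adjacent u v = (cell_of v == ((cell_of u).1, (cell_of u).2.+1)).
Proof.
rewrite /adjacent /cell_of xpair_eqE /= [RHS]andbC andbC; congr (_ && _).
apply/eqP/eqP => [->//|eq_i].
by have := congr1 (nth (box_row u) p) eq_i; rewrite !nth_index ?box_row_pos.
Qed.

Definition entry_of F c : pred nat :=
  fun k => [exists u, (cell_of u == c) && redn (F u) k].

Lemma entry_ofE F u (k : nat) : entry_of F (cell_of u) k = redn (F u) k.
Proof.
apply/existsP/idP => [[v /andP[/eqP/cell_of_inj-> //]]|h].
by exists u; rewrite eqxx.
Qed.

Lemma entry_ofP F c (k : nat) :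
  reflect (exists u (i : 'I_n), [/\ cell_of u = c, i \in F u & k = i]) (entry_of F c k).
Proof.
apply: (iffP existsP) => [[u /andP[/eqP <-]]|[u [i [<- iF ->]]]]; last first.
  by exists u; rewrite eqxx rednE.
by rewrite /redn; case: insubP => // i _ ei iF; exists u, i.
Qed.

Lemma anchorP F u x : F u != set0 ->
  is_anchor (entry_of F) (cell_of u) x <-> x = anchor F u.
Proof.
move=> F0.
have anch : is_anchor (entry_of F) (cell_of u) (anchor F u).
  split.
    have F1 : 0 < #|F u| by rewrite card_gt0.
    rewrite /anchor; have [i iF' ->] := eq_bigmax_cond (nat_of_ord (n := n)) F1.
    by rewrite entry_ofE rednE.
  move=> y; rewrite entry_ofE /redn; case: insubP => // i _ <- iF.
  exact: leq_bigmax_cond.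
split=> [[Px maxx]|-> //]; case: anch => Py maxy.
by apply/eqP; rewrite eqn_leq maxx ?maxy.
Qed.
End Fillings.

(** * Semistandard fillings and the reading-order conditions *)

Section Semistandard.
Variables (n : nat) (a : 'X_{1..n}).
Implicit Types (u v w : box a) (F : filling a) (c : cell).

Lemma cell_of_row_ltn u v : ((cell_of u).1 < (cell_of v).1) = (box_row u < box_row v).
Proof. by rewrite index_positive_ltn // box_row_pos. Qed.

Lemma third_cellE u v w : adjacent u v ->
  third_cell (positive_part a) (cell_of u) (cell_of w) = triple_A u v w || triple_B u v w.
Proof.
rewrite /triple_A /triple_B => uv; rewrite uv /third_cell !cell_of_row_ltn.
rewrite !nth_positive_part ?box_row_pos // /same_col.
by case/andP: uv => /eqP <- /eqP ->; rewrite -!andbA.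
Qed.

(** In a column, [prec] is strict comparison; between row neighbours it is the weak comparison of
    S2. The second conclusion keeps what [sso_first] forgets of S5, the actual rows. *)
Lemma semistandard_sound F : semistandard F ->
  semistandard_on (positive_part a) (entry_of F) /\
  (forall i : 'I_n, 0 < a i ->
     is_anchor (entry_of F) (index i (positive_positions a), 0) i).
Proof.
case/and5P => /forallP F0 s1 s2 s3 /andP[s4 s5].
have S1P u v (i : 'I_n) : i \in F u -> i \in F v -> box_col u = box_col v -> u = v.
  move=> iu iv eq_c; apply/eqP/negPn/negP => ne.
  have /implyP/(_ _)/pred0P/(_ i)/= := forallP (forallP s1 u) v.
  by rewrite iu iv /same_col eq_c eqxx ne => /(_ isT).
have S2P u v (i j : 'I_n) : adjacent u v -> i \in F u -> j \in F v -> j <= i.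
  move=> uv iu jv; have /implyP/(_ uv)/forall_inP/(_ _ iu)/forall_inP/(_ _ jv) // :=
    forallP (forallP s2 u) v.
have anchorE u x : is_anchor (entry_of F) (cell_of u) x -> x = anchor F u.
  by move/anchorP; apply.
have anchor_mem u : exists2 i, i \in F u & anchor F u = i.
  have [+ _] := (anchorP (anchor F u) (F0 u)).2 erefl; rewrite entry_ofE /redn.
  by case: insubP => // i _ <-; exists i.
have anchor_box c x : is_anchor (entry_of F) c x -> exists2 u, cell_of u = c & x = anchor F u.
  by move=> ac; have [/entry_ofP[u [i [uc _ _]]] _] := ac; exists u;
    rewrite // -uc in ac; apply: anchorE.
have S5P u : box_col u = 0 -> anchor F u = box_row u.
  by move=> u0; have /implyP := forallP s5 u; rewrite u0 => /(_ isT)/eqP.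
split; last first.
  move=> i i0; pose u : box a := Tagged (fun i => 'I_(a i)) (Ordinal i0).
  by rewrite -[(_, _)]/(cell_of u); apply/anchorP => //; rewrite S5P.
split.
- move=> c; split=> [/cell_of_surj[u <-]|[x /entry_ofP[u [i [<- _ _]]]]]; last exact: cell_of_col.
  by have [+ _] := (anchorP (anchor F u) (F0 u)).2 erefl; exists (anchor F u).
- move=> c d x /entry_ofP[u [i [<- iu ->]]] /entry_ofP[v [j [<- jv]]].
  by move=> /val_inj eq_ij; rewrite -eq_ij in jv => /(S1P _ _ _ iu jv) ->.
- move=> r c x y /entry_ofP[u [i [eu iu ->]]] /entry_ofP[v [j [ev jv ->]]].
  have /S2P/(_ iu jv) : adjacent u v by rewrite adjacent_cell eu ev.
  by rewrite /prec /=; lia.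
- move=> r c t x y z tc /anchor_box[u eu ->] /anchor_box[v ev ->] /anchor_box[w ew ->].
  have uv : adjacent u v by rewrite adjacent_cell eu ev.
  move: tc; rewrite -eu -ew (third_cellE _ uv) => tc.
  have /implyP/(_ tc) := forallP (forallP (forallP s3 u) v) w.
  by rewrite /is_inversion /prec; lia.
- move=> c d x y z /entry_ofP[u [i [<- iu ->]]] /anchorE -> /anchor_box[v <- ->] ne_uv eq_col.
  have {ne_uv} ne_uv : u != v by apply: contraNneq ne_uv => ->.
  have eq_box : box_col u = box_col v := eq_col.
  have [j ju ej] := anchor_mem u; have [k kv ek] := anchor_mem v.
  rewrite /prec eq_col ltnn !andbF !orbF => lt_iv hr hl.
  (* [sso_free] also speaks of x that are anchors, for which it holds trivially; S4 covers the free
     ones. *)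
  have [eq_iu|ne_iu] := eqVneq (i : nat) (anchor F u); first by rewrite -eq_iu.
  have ne_jk : anchor F u != anchor F v.
    by apply: contraNneq ne_uv => e; apply/eqP/(S1P _ _ j) => //; rewrite (_ : j = k) //;
      apply: val_inj; rewrite /= -ej -ek.
  rewrite ltn_neqAle ne_jk.
  have i_free : i \in free_entries F u by rewrite inE iu.
  have /implyP := forallP (forall_inP (forallP s4 u) i i_free) v; apply.
  apply/and3P; split=> //; first by rewrite /same_col eq_box.
  (* Removing i from u cannot break S2, so only the neighbours of v matter; [hr] and [hl] speak
     about those. *)
  apply/forallP => s; apply/forallP => t; apply/implyP => st.
  apply/forall_inP => i' is'; apply/forall_inP => j' jt.
  have col_st : box_col t = (box_col s).+1 by case/andP: st => _ /eqP.
  have mv w e : e \in move_entry F i u v w -> e \in F w \/ e = i /\ w = v.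
    rewrite ffunE; case: eqP => [->|_]; first by rewrite !inE => /predU1P[->|->]; [right|left].
    by case: eqP => [->|_]; rewrite ?inE; [case/andP|]; left.
  move: (mv _ _ is') (mv _ _ jt) => [is0|[-> es]] [jt0|[-> et]].
  + exact: S2P st is0 jt0.
  + subst t; move: st; rewrite adjacent_cell => /eqP cv.
    have := hl (box_col s) i' col_st; rewrite (_ : (_, _) = cell_of s) ?entry_ofE ?rednE.
      by move=> /(_ is0)/prec_leq.
    by move/(congr1 fst): cv => /= ->.
  + subst s; move: st; rewrite adjacent_cell => /eqP cv.
    have := hr j'; rewrite (_ : (_, _) = cell_of t) ?entry_ofE ?rednE => [/(_ jt0)/prec_leq //|].
    by rewrite cv.
  + exact: leqnn.
- move=> r r' x y lt_r /anchor_box[u eu ->] /anchor_box[v ev ->].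
  have [u0 v0] : box_col u = 0 /\ box_col v = 0 by case: eu ev => _ -> [_ ->].
  rewrite /prec !S5P // -cell_of_row_ltn eu ev lt_r //.
Qed.

Lemma semistandard_complete F :
  semistandard_on (positive_part a) (entry_of F) ->
  (forall i : 'I_n, 0 < a i ->
     is_anchor (entry_of F) (index i (positive_positions a), 0) i) ->
  semistandard F.
Proof.
case=> dom col row triple free _ first.
have F0 u : F u != set0.
  have /dom[x] := cell_of_col u; rewrite entry_ofE /redn.
  by case: insubP => // i _ _ iu; apply/set0Pn; exists i.
have entryI u (i : 'I_n) : i \in F u -> entry_of F (cell_of u) i by rewrite entry_ofE rednE.
have anch u : is_anchor (entry_of F) (cell_of u) (anchor F u) by apply/anchorP.
have S2P : S2 F.
  apply/forallP => u; apply/forallP => v; apply/implyP => uv.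
  apply/forall_inP => i iu; apply/forall_inP => j jv.
  move: uv; rewrite adjacent_cell => /eqP cv.
  have := row (cell_of u).1 (cell_of u).2 i j; rewrite -cv => /(_ (entryI _ _ iu) (entryI _ _ jv)).
  by move/prec_leq.
apply/and5P; split=> //; first exact/forallP.
- apply/forallP => u; apply/forallP => v; apply/implyP => /andP[/eqP eq_c ne].
  apply/pred0P => i /=; apply/negbTE/negP => /andP[iu iv].
  case/eqP: ne; apply/cell_of_inj.
  exact: col (entryI _ _ iu) (entryI _ _ iv) _.
- apply/forallP => u; apply/forallP => v; apply/forallP => w; apply/implyP => tr.
  have uv : adjacent u v by case/orP: tr => /and4P[].
  have cv : cell_of v = ((cell_of u).1, (cell_of u).2.+1) by apply/eqP; rewrite -adjacent_cell.
  have := triple (cell_of u).1 (cell_of u).2 (cell_of w) _ _ _ _ (anch u) _ (anch w).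
  rewrite -cv => /(_ (anchor F v)); rewrite -[(_, _)]/(cell_of u) (third_cellE _ uv).
  move=> /(_ tr (anch v)).
  have le : anchor F v <= anchor F u.
    have := row (cell_of u).1 (cell_of u).2 (anchor F u) (anchor F v); rewrite -cv.
    by move=> /(_ (anch u).1 (anch v).1)/prec_leq.
  have colv : (cell_of v).2 = (cell_of u).2.+1 by rewrite cv.
  have : (cell_of w).2 = (cell_of v).2 \/ (cell_of w).2 = (cell_of u).2.
    by case/orP: tr => /and4P[_ /eqP]; [left | right].
  by rewrite /is_inversion /prec; lia.
apply/andP; split.
- apply/forallP => u; apply/forall_inP => i; rewrite inE => /andP[iu _].
  apply/forallP => v; apply/implyP => /and3P[/eqP uv lt_iv s2].
  have [->//|ne] := eqVneq u v.
  have mvE w : w != v -> w != u -> move_entry F i u v w = F w.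
    by move=> /negPf wv /negPf wu; rewrite ffunE wv wu.
  have iv : i \in move_entry F i u v v by rewrite ffunE eqxx !inE eqxx.
  have col_ne w : box_col w <> box_col v -> w != v /\ w != u.
    by move=> h; split; apply/eqP => e; apply: h; rewrite e ?uv.
  suff : prec (cell_of u) (anchor F u) (cell_of v) (anchor F v).
    by move/prec_leq.
  apply: (free _ _ i) => //; first exact: entryI.
  + by apply: contraNneq ne => /cell_of_inj ->.
  + by rewrite /prec lt_iv.
  + move=> t /entry_ofP[w [j [cw jw ->]]].
    have cwv : box_col w = (box_col v).+1 by move/(congr1 snd): cw.
    have [wv wu] : w != v /\ w != u by apply: col_ne; rewrite cwv; lia.
    have vw : adjacent v w by rewrite adjacent_cell cw.
    have /implyP/(_ vw)/forall_inP/(_ _ iv)/forall_inP/(_ j) := forallP (forallP s2 v) w.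
    by rewrite mvE // => /(_ jw); rewrite /prec /= uv; lia.
  move=> c t vc /entry_ofP[w [j [cw jw ->]]].
  have cwv : box_col w = c by move/(congr1 snd): cw.
  rewrite /= in vc.
  have [wv wu] : w != v /\ w != u by apply: col_ne; rewrite cwv vc; lia.
  have vw : adjacent w v by rewrite adjacent_cell cw /= -vc.
  have /implyP/(_ vw)/forall_inP/(_ j) := forallP (forallP s2 w) v.
  rewrite mvE // => /(_ jw)/forall_inP/(_ _ iv).
  by rewrite /prec /= uv vc; lia.
apply/forallP => u; apply/implyP => /eqP u0.
have ua : 0 < a (box_row u) by rewrite -mem_positive_positions box_row_pos.
have := first _ ua; rewrite (_ : (_, _) = cell_of u); last by rewrite /cell_of u0.
by move/anchorP => <-.
Qed.
End Semistandard.

(** * The word of a filling *)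

Lemma eq_psum f f' r r' : f =1 f' -> r =1 r' -> psum f r =1 psum f' r'.
Proof. by move=> ef er k; apply: eq_bigr => i _; rewrite ef er. Qed.

Lemma eq_glides_on N D n f f' r r' : f =1 f' -> r =1 r' ->
  glides_on N D n f r -> glides_on N D n f' r'.
Proof.
move=> ef er [An rk Dk]; split.
- by rewrite -(eq_psum ef er).
- by move=> k ltk; rewrite -er -ef -(eq_psum ef er); apply: rk.
- by move=> k p ltk; rewrite -!(eq_psum ef er) -er; apply: Dk.
Qed.

Section Blocks.
Variables (n : nat) (a : 'X_{1..n}) (F : filling a).

Definition row_block (k : nat) : seq cell :=
  sort (fun c d => d.2 <= c.2) [seq cell_of v | v <- enum {: box a} & redn (F v) k].

Definition word : seq cell := merged (0, 0) row_block n.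
Definition reds : {set 'I_n} := [set i : 'I_n | red_at (0, 0) row_block i].

Lemma mem_row_block c k : (c \in row_block k) = entry_of F c k.
Proof.
rewrite mem_sort; apply/mapP/existsP => [[v]|[v /andP[/eqP <- kv]]].
  by rewrite mem_filter => /andP[kv _] ->; exists v; rewrite eqxx.
by exists v; rewrite // mem_filter kv mem_enum.
Qed.

Lemma row_block_out k : n <= k -> row_block k = [::].
Proof.
move=> le_nk; apply/eqP; rewrite -size_eq0 size_sort size_map size_filter.
rewrite (eq_count (a2 := pred0)) ?count_pred0 // => v.
by rewrite /redn insubF // ltnNge le_nk.
Qed.

Lemma block_filling_row_block c k : block_filling n row_block c k = entry_of F c k.
Proof.
rewrite /block_filling mem_row_block andb_idl // => /entry_ofP[u [i [_ _ ->]]].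
exact: ltn_ord.
Qed.

Lemma size_row_block k : size (row_block k) = multn (filling_wt F) k.
Proof.
have [ltk|gek] := ltnP k n; last first.
  by rewrite row_block_out // /multn insubF // ltnNge gek.
rewrite -[k]/(nat_of_ord (Ordinal ltk)) multnE mnmE size_sort size_map.
rewrite size_filter -sum1_count -sum1_card big_enum_cond; apply: eq_bigl => u.
by rewrite inE rednE.
Qed.

Lemma redn_reds : redn reds =1 red_at (0, 0) row_block.
Proof.
move=> k; have [ltk|gek] := ltnP k n.
  by rewrite -[k in LHS]/(nat_of_ord (Ordinal ltk)) rednE inE.
by rewrite /redn insubF 1?ltnNge ?gek // /red_at /overlaps row_block_out // andbF.
Qed.

Hypothesis Fss : semistandard F.

(** A value occurs at most once in a column, so sorting by column is strict. *)
Lemma row_block_sorted k : sorted gtcol (row_block k).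
Proof.
have [/sso_col col _] := semistandard_sound Fss.
have -> : sorted gtcol (row_block k) = sorted gtn (map snd (row_block k)).
  by rewrite sorted_map.
rewrite gtn_sorted_uniq_geq sorted_map; apply/andP; split; last first.
  by apply: sort_sorted => c d; apply: leq_total.
rewrite map_inj_in_uniq ?sort_uniq.
  by rewrite (map_inj_uniq (@cell_of_inj _ _)) filter_uniq ?enum_uniq.
by move=> c d; rewrite !mem_row_block; apply: col.
Qed.

Lemma glides_on_word :
  glides_on (size word) (descents word) n (multn (filling_wt F)) (redn reds).
Proof.
apply: eq_glides_on (glides_on_merged (fun k _ => row_block_sorted k)) => k /=.
  exact: size_row_block.
by rewrite redn_reds.
Qed.

Lemma word_stutter_free : stutter_free word.
Proof. exact: stutter_free_merged_sorted (fun k _ => row_block_sorted k). Qed.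

(** Word, weight and red set thus determine all entries of the filling. *)
Lemma row_block_glide k : k < n ->
  row_block k = glide_block word (multn (filling_wt F)) (redn reds) k.
Proof.
move=> ltk; rewrite -[LHS](glide_block_merged _ ltk) /glide_block.
have e1 : size \o row_block =1 multn (filling_wt F) by exact: size_row_block.
have e2 : red_at (0, 0) row_block =1 redn reds by move=> j; rewrite redn_reds.
by rewrite !(eq_psum e1 e2) e2.
Qed.

Lemma word_filling_semistandard :
  semistandard_on (positive_part a) (word_filling word).
Proof.
have [Fon _] := semistandard_sound Fss.
apply/(semistandard_glide_block glides_on_word).
apply: (eq_semistandard_on (n := n)) Fon => c k.
  by rewrite -block_filling_row_block => /andP[/ltnW].
rewrite -block_filling_row_block /block_filling; case: (ltnP k n) => //= ltk.
by rewrite row_block_glide.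
Qed.

Lemma sumn_positive_part : sumn (positive_part a) = mdeg a.
Proof.
rewrite sumnE big_map big_filter big_enum_cond mdegE big_mkcond /=.
by apply: eq_bigr => i _; case: posnP.
Qed.

Lemma card_box : #|{: box a}| = mdeg a.
Proof.
rewrite card_tagged sumnE big_map big_enum /= mdegE.
by apply: eq_bigr => i _; rewrite card_ord.
Qed.

(** Each box holds exactly one entry that is not free, its anchor. *)
Lemma filling_ex_wt : filling_ex F + mdeg a = mdeg (filling_wt F).
Proof.
have /and5P[/forallP F0 _ _ _ _] := Fss.
rewrite -card_box -sum1_card -big_split /= mdegE.
under [RHS]eq_bigr => i _ do rewrite mnmE -sum1_card big_mkcond.
rewrite exchange_big /=; apply: eq_bigr => u _.
under [RHS]eq_bigr => i _ do rewrite inE.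
rewrite -big_mkcond sum1_card.
have Fu : 0 < #|F u| by rewrite card_gt0 F0.
have [i iu ei] := eq_bigmax_cond (nat_of_ord (n := n)) Fu.
rewrite [RHS](cardsD1 i) iu addnC; congr (_ + _); apply: eq_card => j.
by rewrite !inE /anchor ei andbC.
Qed.

Lemma filling_ex_word : filling_ex F + mdeg a = size word + #|reds|.
Proof. by rewrite filling_ex_wt (glides_on_mdeg glides_on_word). Qed.

(** Every box occurs in the word. Hence the exponent |w| - |alpha| of beta is not truncated. *)
Lemma mdeg_word : mdeg a <= size word.
Proof.
rewrite -card_box cardE -(size_map (@cell_of _ a)); apply: uniq_leq_size.
  by rewrite (map_inj_uniq (@cell_of_inj _ _)) enum_uniq.
move=> _ /mapP[u _ ->].
have [Fon _] := semistandard_sound Fss.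
have /(sso_dom Fon)[k] := cell_of_col u.
rewrite -block_filling_row_block => /andP[ltk].
by rewrite row_block_glide // => /mem_drop/mem_take.
Qed.
End Blocks.

(** * Recovering a filling from its entries *)

Lemma is_anchor_inj P c x y : is_anchor P c x -> is_anchor P c y -> x = y.
Proof. by move=> [Px mx] [Py my]; apply/eqP; rewrite eqn_leq my ?mx. Qed.

Lemma eq_is_anchor (P P' : cell -> pred nat) c x : P =2 P' -> is_anchor P c x -> is_anchor P' c x.
Proof. by move=> eqP [Px mx]; split=> [|y]; rewrite -eqP //; apply: mx. Qed.

Section Injectivity.
Variable n : nat.

(** By S5 the anchors of the first column are the nonempty rows, and [positive_part] gives their
    lengths. *)
Lemma semistandard_shape_inj (a a' : 'X_{1..n}) (F : filling a) (F' : filling a') :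
  positive_part a = positive_part a' -> semistandard F -> semistandard F' ->
  entry_of F =2 entry_of F' -> a = a'.
Proof.
move=> eq_pos /semistandard_sound[_ anc] /semistandard_sound[_ anc'] eqF.
have sz : size (positive_positions a) = size (positive_positions a').
  by have := congr1 size eq_pos; rewrite !size_map.
have eq_p : positive_positions a = positive_positions a'.
  case E: (positive_positions a) => [|i0 s].
    by move: sz; rewrite E => /esym/size0nil.
  rewrite -E; apply: (@eq_from_nth _ i0) => // r ltr.
  have ltr' : r < size (positive_positions a') by rewrite -sz.
  have := mem_nth i0 ltr; have := mem_nth i0 ltr'; rewrite !mem_positive_positions.
  move=> /anc' h' /anc h; move: h h'.
  rewrite !index_uniq ?positive_positions_uniq // => /(eq_is_anchor eqF) h h'.
  exact/val_inj/(is_anchor_inj h h').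
apply/mnmP => i; case: (boolP (i \in positive_positions a)) => ip.
  by rewrite -!nth_positive_part -?eq_p // eq_pos eq_p.
have := ip; rewrite eq_p; move: ip.
by rewrite !mem_positive_positions -!eqn0Ngt => /eqP-> /eqP->.
Qed.

Lemma entry_of_inj (a : 'X_{1..n}) (F F' : filling a) : entry_of F =2 entry_of F' -> F = F'.
Proof.
move=> eqF; apply/ffunP => u; apply/setP => i.
by rewrite -!rednE -!entry_ofE eqF.
Qed.
End Injectivity.

Section Realization.
Variables (n : nat) (alpha : seq nat) (P : cell -> pred nat).
Hypotheses (alpha_comp : is_composition alpha) (Pss : semistandard_on alpha P).
Hypothesis P_lt : forall c k, P c k -> k < n.

(** The r-th row is placed at the height given by the anchor of (r, 0); by [sso_first] these heights
    increase, so the positive part is [alpha] in the right order. *)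
Lemma realize_filling : exists (a : 'X_{1..n}) (F : filling a),
  [/\ positive_part a = alpha, semistandard F & entry_of F =2 P].
Proof.
have [q qP] : exists q : 'I_(size alpha) -> 'I_n, forall r, is_anchor P (nat_of_ord r, 0) (q r).
  apply: (@fin_all_exists _ (fun _ => 'I_n) (fun r i => is_anchor P (nat_of_ord r, 0) i)) => r.
  have /(sso_dom Pss (nat_of_ord r, 0)) exP : 0 < nth 0 alpha r.
    by apply: (all_nthP 0 alpha_comp).
  have bound k : P (nat_of_ord r, 0) k -> k <= n by move/P_lt/ltnW.
  have [k Pk maxk] := ex_maxnP exP bound.
  by exists (Ordinal (P_lt Pk)).
have q_mono (r s : 'I_(size alpha)) : r < s -> q r < q s.
  by move=> lt_rs; have := sso_first Pss lt_rs (qP r) (qP s); rewrite /prec ltnn andbF orbF.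
have q_inj : injective q.
  move=> r s eq_q; apply: val_inj => /=.
  by case: (ltngtP r s) => // /q_mono; rewrite eq_q ltnn.
(* As [q] is injective, the sum has one term for a row in its image and is 0 elsewhere. *)
pose a : 'X_{1..n} := [multinom \sum_(r | q r == i) nth 0 alpha r | i < n].
have aq r : a (q r) = nth 0 alpha r.
  by rewrite mnmE (big_pred1 r) // => s; rewrite /= (inj_eq q_inj).
have p_eq : positive_positions a = [seq q r | r <- enum 'I_(size alpha)].
  apply: (@irr_sorted_eq _ (fun i j : 'I_n => i < j)).
  - by move=> i j k; apply: ltn_trans.
  - by move=> i; apply: ltnn.
  - exact: positive_positions_sorted.
  - have := iota_ltn_sorted 0 (size alpha); rewrite -val_enum_ord sorted_map.
    by apply: homo_sorted => r s; apply: q_mono.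
  move=> i; rewrite mem_positive_positions; apply/idP/mapP => [|[r _ ->]]; last first.
    by rewrite aq; apply: (all_nthP 0 alpha_comp).
  have [r /eqP <- _|none] := pickP (fun r => q r == i); first by exists r; rewrite ?mem_enum.
  by rewrite mnmE big_pred0.
have pos : positive_part a = alpha.
  rewrite /positive_part p_eq -map_comp (eq_map aq).
  apply: (@eq_from_nth _ 0) => [|r]; rewrite size_map size_enum_ord // => ltr.
  by rewrite (nth_map (Ordinal ltr)) ?size_enum_ord // nth_enum_ord.
pose F : filling a := [ffun u => [set i : 'I_n | P (cell_of u) i]].
have FP : entry_of F =2 P.
  move=> c k; apply/entry_ofP/idP => [[u [i [<- + ->]]]|Pck]; first by rewrite ffunE inE.
  have [|u uc] := @cell_of_surj _ a c; first by rewrite pos; apply/(sso_dom Pss); exists k.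
  by exists u, (Ordinal (P_lt Pck)); rewrite ffunE inE uc.
exists a, F; split=> //; apply: semistandard_complete.
  rewrite pos; apply: (eq_semistandard_on (n := n)) Pss => [c k /P_lt/ltnW //|c k].
  by rewrite FP.
move=> i; rewrite -mem_positive_positions p_eq => /mapP[r _ ->].
rewrite index_map // index_enum_ord.
by apply: eq_is_anchor (qP r) => c k; rewrite FP.
Qed.
End Realization.

(** * Expansion *)

Local Open Scope ring_scope.

Lemma big_fibers (I J : eqType) (V : nmodType) (s : seq I) (key : I -> J) (f : I -> V) :
  \sum_(i <- s) f i = \sum_(j <- undup (map key s)) \sum_(i <- s | key i == j) f i.
Proof.
under [RHS]eq_bigr => j _ do rewrite big_mkcond.
rewrite exchange_big /=; apply: eq_big_seq => i is_.
rewrite (bigD1_seq (key i)) ?mem_undup ?map_f ?undup_uniq //= eqxx big1 ?addr0 // => j /negPf.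
by rewrite eq_sym => ->.
Qed.

Lemma eq_merged (T : eqType) (x0 : T) (B B' : nat -> seq T) n :
  (forall k, (k < n)%N -> B k = B' k) -> merged x0 B n = merged x0 B' n.
Proof.
by elim: n => //= n IHn eqB; rewrite IHn ?eqB // => k ltk; apply: eqB; apply: ltnW.
Qed.

Lemma glides_on_run_lengths w n f r :
  glides_on (size w) (descents w) n f r <->
  glides_on (sumn (run_lengths w)) (part_sums (run_lengths w)) n f r.
Proof.
rewrite sumn_run_lengths; split=> -[An rk Dk]; split=> // k p ltk.
  by rewrite part_sums_run_lengths; apply: Dk.
by rewrite -part_sums_run_lengths; apply: Dk.
Qed.

Section Expansion.
Variables (n : nat) (alpha : seq nat).
Hypothesis alpha_comp : is_composition alpha.

Definition shaped_filling := {a : 'X_{1..n < (sumn alpha).+1} & filling (bmnm a)}.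
Implicit Types (t : shaped_filling) (m : 'X_{1..n}).

Definition alpha_semistandard t :=
  (positive_part (bmnm (tag t)) == alpha) && semistandard (tagged t).
Definition shaped_term t : {mpoly {poly int}[n]} :=
  ('X ^+ filling_ex (tagged t) : {poly int}) *: 'X_[filling_wt (tagged t)].
Definition shaped_word t := word (tagged t).
Definition shaped_reds t := reds (tagged t).

Lemma quasiGrothendieckE :
  quasiGrothendieck n alpha = \sum_(t | alpha_semistandard t) shaped_term t.
Proof.
by rewrite /quasiGrothendieck /lascoux_atom
  (sig_big_dep _ (fun a : 'X_{1..n < _} => [pred F : filling a | semistandard F])
     (fun a (F : filling (bmnm a)) => ('X ^+ filling_ex F : {poly int}) *: 'X_[filling_wt F])).
Qed.

Lemma sumn_alpha t : alpha_semistandard t -> mdeg (bmnm (tag t)) = sumn alpha.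
Proof. by case/andP=> /eqP pa _; rewrite -sumn_positive_part pa. Qed.

(** The data determine the blocks, these the entries, and the first-column anchors then determine
    the shape. *)
Lemma shaped_filling_inj t t' : alpha_semistandard t -> alpha_semistandard t' ->
  shaped_word t = shaped_word t' -> filling_wt (tagged t) = filling_wt (tagged t') ->
  shaped_reds t = shaped_reds t' -> t = t'.
Proof.
case: t t' => [a F] [a' F'] /andP[/eqP /= pa ss] /andP[/eqP /= pa' ss'].
rewrite /shaped_word /shaped_reds /= => eq_w eq_m eq_r.
have eqF : entry_of F =2 entry_of F'.
  move=> c k; rewrite -!block_filling_row_block /block_filling.
  case: (ltnP k n) => //= ltk.
  by rewrite !row_block_glide // eq_w eq_m eq_r.
have eq_a : a = a'.
  by apply/val_inj/(semistandard_shape_inj _ ss ss' eqF); rewrite pa pa'.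
by subst a'; rewrite (entry_of_inj eqF).
Qed.

(** The word of [t0] is cut along the given glide. Cutting preserves semistandardness, and gluing
    returns the word, the weight and the red set. *)
Lemma shaped_filling_exists t0 m red :
  alpha_semistandard t0 ->
  glides_on (size (shaped_word t0)) (descents (shaped_word t0)) n (multn m) (redn red) ->
  exists t, [/\ alpha_semistandard t, shaped_word t = shaped_word t0,
                filling_wt (tagged t) = m & shaped_reds t = red].
Proof.
case: t0 => a0 F0 /andP[/eqP /= pa0 ss0]; rewrite /shaped_word /= => gl.
set w := word F0 in gl *; set B := glide_block w (multn m) (redn red).
have Bss : semistandard_on alpha (block_filling n B).
  apply/(semistandard_glide_block gl).
  by rewrite -pa0; apply: word_filling_semistandard.
(* The shape is read off the new first column and may differ from that of [t0]. *)
have [a [F [pa ss FB]]] : exists (a : 'X_{1..n}) (F : filling a),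
    [/\ positive_part a = alpha, semistandard F & entry_of F =2 block_filling n B].
  by apply: realize_filling => // c k /andP[].
have lt_a : (mdeg a < (sumn alpha).+1)%N by rewrite -pa sumn_positive_part.
have eqB k : (k < n)%N -> row_block F k = B k.
  move=> ltk; apply: (irr_sorted_eq gtcol_trans).
  - by move=> c; rewrite /gtcol ltnn.
  - exact: row_block_sorted.
  - exact: glide_block_sorted gl _ ltk.
  by move=> c; rewrite mem_row_block FB /block_filling ltk.
have [An rk _] := gl.
have sf : stutter_free w := word_stutter_free ss0.
exists (Tagged (fun a : 'X_{1..n < (sumn alpha).+1} => filling (bmnm a))
  (F : filling (bmnm (BMultinom lt_a)))).
split=> /=.
- by rewrite /alpha_semistandard /= pa eqxx.
- rewrite /word (eq_merged _ eqB).
  have [-> _] := merged_glide_block (0, 0)%N sf An rk (leqnn n).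
  by rewrite An take_size.
- apply/mnmP => i; rewrite -!multnE -size_row_block eqB //.
  exact: size_glide_block An rk _ (ltn_ord i).
apply/setP => i; rewrite inE /red_at (eq_merged _ (B' := B)); last first.
  by move=> k lti; apply: eqB; apply: ltn_trans (ltn_ord i).
rewrite eqB // -/(red_at _ B i) -rednE.
have [_ h] := merged_glide_block (0, 0)%N sf An rk (ltnW (ltn_ord i)).
exact: h.
Qed.

(** For each monomial, [shaped_reds] is a bijection from the fillings with this word onto the glides
    of gamma(w); the excess of a filling is |w| - |alpha| plus the number of red values. *)
Lemma word_class_expansion t0 : alpha_semistandard t0 ->
  \sum_(t | alpha_semistandard t && (shaped_word t == shaped_word t0)) shaped_term t =
  ('X ^+ (size (shaped_word t0) - sumn alpha) : {poly int}) *: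
    multifundamental n (run_lengths (shaped_word t0)).
Proof.
move=> ss0; set w := shaped_word t0; set g := run_lengths w.
have g_comp : is_composition g by apply: run_lengths_composition.
(* The filling [t0] itself is a glide of gamma(w), so gamma(w) has at most n parts. *)
have le_gn : (size g <= n)%N.
  have /andP[_ ss] := ss0.
  by have [] := glides_on_cuts g_comp ((glides_on_run_lengths _ _ _ _).1 (glides_on_word ss)).
have le_alpha : (sumn alpha <= size w)%N.
  by rewrite -(sumn_alpha ss0); have /andP[_ ss] := ss0; apply: mdeg_word.
rewrite /multifundamental le_gn; apply/mpolyP => m.
rewrite mcoeffZ mcoeff_glide_poly // raddf_sum /=.
pose A := [set t | [&& alpha_semistandard t, shaped_word t == w & filling_wt (tagged t) == m]].
have injA : {in A &, injective shaped_reds}.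
  move=> t t'; rewrite !inE => /and3P[ss /eqP ew /eqP em] /and3P[ss' /eqP ew' /eqP em'].
  by apply: shaped_filling_inj; rewrite ?ew ?em.
have imA : [set red | is_glide (pad_left n g) m red] = shaped_reds @: A.
  apply/setP => red; rewrite inE; apply/idP/imsetP => [|[t]].
    move/is_glideP => /(_ g_comp le_gn)/glides_on_run_lengths/(shaped_filling_exists ss0).
    by move=> [t [ss ew em er]]; exists t; rewrite // inE ss ew em !eqxx.
  rewrite inE => /and3P[/andP[_ ss] /eqP ew /eqP em] ->.
  apply/is_glideP => //; apply/glides_on_run_lengths.
  by rewrite -em -ew; apply: glides_on_word.
rewrite [X in _ = _ * X](eq_bigl (mem (shaped_reds @: A))); last first.
  by move=> red; rewrite /= -imA inE.
rewrite big_imset //= mulr_sumr.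
under eq_bigr => t _ do rewrite mcoeffZ mcoeffX.
rewrite (bigID (fun t => filling_wt (tagged t) == m)) /= [X in _ + X]big1 ?addr0; last first.
  by move=> t /andP[_ /negPf ->]; rewrite mulr0.
apply: eq_big => [t|t /andP[/andP[ss /eqP ew] /eqP ->]]; first by rewrite inE andbA.
rewrite eqxx mulr1 -exprD; congr ('X ^+ _).
have /andP[_ sst] := ss.
have := filling_ex_word sst; rewrite (sumn_alpha ss) -/(shaped_word t) ew -/(shaped_reds t).
by move=> eq_ex; rewrite addnBAC // -eq_ex addnK.
Qed.
End Expansion.

Theorem theorem1p1 (n : nat) (hn : (1 <= n)%N)
    (alpha : seq nat) (halpha : is_composition alpha) :
  is_quasisymmetric (quasiGrothendieck n alpha) /\
  exists (gammas : seq (seq nat)) (J : seq nat -> {poly int}),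
    [/\ uniq gammas,
        all is_composition gammas,
        (forall (g : seq nat) (k : nat), 0 <= (J g)`_k)
      & quasiGrothendieck n alpha =
          \sum_(g <- gammas) J g *: multifundamental n g].
Proof.
pose fillings := [seq t <- enum {: shaped_filling n alpha} | alpha_semistandard t].
pose words := undup [seq shaped_word t | t <- fillings].
pose gammas := undup [seq run_lengths w | w <- words].
(* Each word with composition g contributes one power of beta, so the coefficients are
   nonnegative. *)
pose J g : {poly int} := \sum_(w <- words | run_lengths w == g) 'X ^+ (size w - sumn alpha).
have expansion : quasiGrothendieck n alpha = \sum_(g <- gammas) J g *: multifundamental n g.
  transitivity (\sum_(w <- words)
      ('X ^+ (size w - sumn alpha) : {poly int}) *: multifundamental n (run_lengths w)).
    have -> : quasiGrothendieck n alpha = \sum_(t <- fillings) shaped_term t.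
      by rewrite quasiGrothendieckE big_filter big_enum_cond.
    rewrite (big_fibers _ (@shaped_word n alpha)).
    apply: eq_big_seq => w; rewrite mem_undup => /mapP[t0].
    rewrite mem_filter => /andP[ss0 _] ->.
    by rewrite -word_class_expansion // big_filter_cond big_enum_cond.
  rewrite (big_fibers _ run_lengths); apply: eq_bigr => g _.
  by rewrite scaler_suml; apply: eq_bigr => w /eqP ->.
have gammas_comp : all is_composition gammas.
  apply/allP => g; rewrite mem_undup => /mapP[w _ ->].
  exact: run_lengths_composition.
split.
  (* Quasisymmetry is inherited from the multifundamental polynomials through the expansion. *)
  move=> m1 m2 eq_pos; rewrite expansion !raddf_sum /=; apply: eq_big_seq => g gg.
  rewrite !mcoeffZ; congr (_ * _); apply: is_quasisymmetric_multifundamental eq_pos.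
  exact: (allP gammas_comp).
exists gammas, J; split=> //; first exact: undup_uniq.
move=> g k; rewrite coef_sum sumr_ge0 // => w _.
by rewrite coefXn ler0n.
Qed.
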